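(* Let $\Gamma^*$ be a mediated hidden-role game with history set $H$, and let $R\ge 2$ and $M\ge |H|$. Then there exists a strategy profile $x$ for the MAX-team players of $\mathrm{CSplit}(\mathrm{Comm}^{M,R}_{\mathrm{priv}}(\Gamma^* ))$ whose value (against a best-responding adversary) equals $\mathrm{CVal}_{\mathrm{priv}}(\Gamma^* )$, i.e. $(M,R,x)$ is an exact coordinated private-communication hidden-role equilibrium, and in which at every step of the game the following happen in sequence: (1) every player on team MAX sends its observation privately to the mediator; (2) the mediator privately sends to every player (whether on team MAX or MIN) a recommended action; (3) every player on team MAX plays its recommended action. (Players on team MIN are unconstrained and may send arbitrary messages and deviate from recommendations.)
   Context: An extensive-form game here has players $1,\dots,n$ and a chance player; a finite rooted tree of histories $H$ with leaf set $Z$; at each nonterminal $h$ each player $i$ (and chance) has an action set $A_i(h)$, and the children of $h$ correspond to joint (simultaneous) action profiles; chance plays a fixed known distribution at each node; each player $i$ has an observation function $o_i$ on nonterminal histories (equal observations imply equal action sets) and a utility $u_i:Z\to\mathbb R$. Player $i$'s information state at $h$ is the sequence of its observations and own actions along the path to $h$; a pure strategy maps information states to legal actions; a mixed strategy is a distribution over pure strategies. An adversarial team game has a fixed assignment of players to teams MAX and MIN and a function $u:Z\to\mathbb R$ with $u_i=u$ for MAX players and $u_i=-u$ for MIN players. Its TME value is $\max_x\min_y u(x,y)$, with $x$ ranging over profiles of independent mixed strategies of the MAX players and $y$ over profiles of independent mixed strategies of the MIN players; the value of a MAX profile $x$ is $\min_y u(x,y)$. A hidden-role game is an extensive-form game in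 which at the root only chance acts, drawing a team assignment $t\in\{\mathrm{MAX},\mathrm{MIN}\}^n$ from a distribution $\mathcal D$; each player $i$ privately observes (at least) $t_i$, and each player with $t_i=\mathrm{MIN}$ privately observes all of $t$; there is $u:Z\to\mathbb R$ such that player $i$'s utility at $z$ is $u(z)$ if $t_i=\mathrm{MAX}$ and $-u(z)$ otherwise. It is mediated if there is a designated player (the mediator) with $t_{\text{mediator}}=\mathrm{MAX}$ for every $t$ in the support of $\mathcal D$. Communication extensions: for integers $M,R\ge1$, $\mathrm{Comm}^{M,R}_{\mathrm{pub}}(\Gamma)$ is the game which, starting at the root of $\Gamma$, repeats at each step of $\Gamma$: each player $i$ observes $o_i(h)$; then $R$ rounds of communication, in each of which every player $i$ simultaneously chooses a public message $m_i\in\{1,\dots,M\}$ and all players observe $(m_1,\dots,m_n)$; then all players (and chance, by its fixed distribution) simultaneously choose actions of $\Gamma$, advancing $h$. $\mathrm{Comm}^{M,R}_{\mathrm{priv}}(\Gamma)$ is identical except that in each round each player $i$ additionally chooses for every $j\ne i$ a private message $m_{i\to j}\in\{1,\dots,M\}\cup\{\bot\}$ ($\bot$ meaning no message), and each player $j$ additionally observes $(m_{1\to j},\dots,m_{n\to j})$ and the set of pairs $(i,l)$ with $m_{i\to l}\ne\bot$. Also $\mathrm{Comm}^{M,R}_{\mathrm{none}}(\Gamma)=\Gamma$. Split-personality forms: $\mathrm{USplit}(\Gamma)$ is the adversarial team game with $2n$ players $i^+$ (team MAX) and $i^-$ (team MIN), where $i^+$ (resp. $i^-$) observes player $i$'s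 observations and chooses player $i$'s actions in histories where $t_i=\mathrm{MAX}$ (resp. $t_i=\mathrm{MIN}$), with team utility $u$. $\mathrm{CSplit}(\Gamma)$ is obtained from $\mathrm{USplit}(\Gamma)$ by merging all players $i^-$ into a single MIN player (the adversary) who observes all their observations and chooses all their actions. Values: for $c\in\{\mathrm{none},\mathrm{pub},\mathrm{priv}\}$, $\mathrm{CVal}_c(\Gamma)=\sup_{M,R}$ (TME value of $\mathrm{CSplit}(\mathrm{Comm}^{M,R}_c(\Gamma))$), and $\mathrm{UVal}_c(\Gamma)$ is defined likewise with $\mathrm{USplit}$. An $\varepsilon$-coordinated hidden-role equilibrium with communication $c$ is a triple $(M,R,x)$ with $x$ a MAX-team profile in $\mathrm{CSplit}(\mathrm{Comm}^{M,R}_c(\Gamma))$ of value at least $\mathrm{CVal}_c(\Gamma)-\varepsilon$ (exact if $\varepsilon=0$); the uncoordinated version uses $\mathrm{USplit}$ and $\mathrm{UVal}$.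
   Formalization: Communication rounds (and steps (1)–(3)) take place at every nonterminal history except the root, where only chance moves: before the team assignment is drawn, the split game does not say which personality would send a player's messages. *)

(* Defs.v *)
From HB Require Import structures.
From mathcomp Require Import all_boot all_order all_algebra.
From mathcomp Require Import boolp classical_sets reals.
Set Implicit Arguments. Set Strict Implicit. Unset Printing Implicit Defensive.
Import Order.TTheory GRing.Theory Num.Theory.
Local Open Scope ring_scope.
Local Open Scope classical_set_scope.

(* One step of play: a joint (simultaneous) action profile of the players and
   an action of chance.  A history is the sequence of steps from the root. *)
Notation stepT n A C := ({ffun 'I_n -> A} * C)%type.

Section Games.
Variable R : realType.

(* Histories are sequences of steps; [valid] carves out the tree H.          *)
(* [team c i = true] means that player i is on team MAX in the team          *)
(* assignment t drawn by chance action c at the root.                         *)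
(* The utility of player i at leaf z is [util z] if t_i = MAX, -[util z]     *)
(* otherwise (built into the definitions of the split forms below).          *)
Record hrg := HRG {
  np : nat;
  Act : finType;
  CAct : finType;
  Obs : Type;
  legal : seq (stepT np Act CAct) -> 'I_np -> Act -> bool;
  chance : seq (stepT np Act CAct) -> CAct -> R;
  terminal : seq (stepT np Act CAct) -> bool;
  obs : 'I_np -> seq (stepT np Act CAct) -> Obs;
  depth : nat;
  team : CAct -> 'I_np -> bool;                       (* t drawn at root, true = MAX *)
  util : seq (stepT np Act CAct) -> R;
  mediator : 'I_np
}.

Arguments legal : clear implicits.
Arguments chance : clear implicits.
Arguments terminal : clear implicits.
Arguments obs : clear implicits.
Arguments team : clear implicits.
Arguments util : clear implicits.
Arguments depth : clear implicits.
Arguments mediator : clear implicits.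

Definition hist (G : hrg) := seq (stepT (np G) (Act G) (CAct G)).

Fixpoint pre_steps (S : Type) (acc : seq S) (h : seq S) : seq (seq S * S) :=
  if h is s :: h' then (acc, s) :: pre_steps (rcons acc s) h' else [::].

Definition valid (G : hrg) (h : hist G) : bool :=
  all (fun p : hist G * stepT (np G) (Act G) (CAct G) => [&& ~~ terminal G p.1,
                    [forall i, legal G p.1 i (p.2.1 i)] &
                    0 < chance G p.1 p.2.2])
      (pre_steps [::] h).
Arguments valid : clear implicits.

(* team assignment at a history (read off the root chance action);
   at the root itself (t not yet drawn, only chance acts) everyone counts
   as MAX by convention -- their root action is forced anyway. *)
Definition teamof (G : hrg) (h : hist G) : 'I_(np G) -> bool :=
  if h is s :: _ then team G s.2 else fun _ => true.
Arguments teamof : clear implicits.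

Fixpoint seqs_len (T : finType) (k : nat) : seq (seq T) :=
  if k is k'.+1 then [seq rcons h s | h <- seqs_len T k', s <- enum T]
  else [:: [::]].

Definition nhist (G : hrg) : nat :=
  count (valid G)
    (flatten [seq seqs_len (stepT (np G) (Act G) (CAct G)) k
             | k <- iota 0 (depth G).+1]).

Definition mediated_hrg (G : hrg) : Prop :=
      (forall h, valid G h -> ~~ terminal G h -> forall i, exists a, legal G h i a) /\
      (forall h, valid G h -> ~~ terminal G h ->
         (forall c, 0 <= chance G h c) /\ \sum_c chance G h c = 1) /\
      (forall h, valid G h -> size h = depth G -> terminal G h) /\
      (forall i h1 h2, valid G h1 -> valid G h2 -> ~~ terminal G h1 -> ~~ terminal G h2 ->
         obs G i h1 = obs G i h2 -> legal G h1 i =1 legal G h2 i) /\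
      (* at the root only chance acts *)
      (~~ terminal G [::] /\ (forall i, #|[pred a | legal G [::] i a]| = 1%N)) /\
      (* each player observes t_i; each MIN player observes all of t *)
      (forall i h1 h2, valid G h1 -> valid G h2 -> size h1 = 1%N -> size h2 = 1%N ->
         ~~ terminal G h1 -> ~~ terminal G h2 -> obs G i h1 = obs G i h2 ->
         teamof G h1 i = teamof G h2 i /\
         (teamof G h1 i = false -> teamof G h1 =1 teamof G h2)) /\
      (forall c, 0 < chance G [::] c -> team G c (mediator G)).

Definition infoT (G : hrg) := (seq (Obs G * Act G) * Obs G)%type.
Definition infostate (G : hrg) (i : 'I_(np G)) (h : hist G) : infoT G :=
  ([seq (obs G i p.1, p.2.1 i) | p : hist G * stepT (np G) (Act G) (CAct G) <- pre_steps [::] h], obs G i h).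
Arguments infostate : clear implicits.

(* information state of the merged adversary: observations and actions of all
   players i with t_i = MIN *)
Definition advinfoT (G : hrg) :=
  (seq {ffun 'I_(np G) -> option (Obs G * Act G)} * {ffun 'I_(np G) -> option (Obs G)})%type.
Definition advinfo (G : hrg) (h : hist G) : advinfoT G :=
  ([seq [ffun i => if teamof G p.1 i then None else Some (obs G i p.1, p.2.1 i)]
   | p : hist G * stepT (np G) (Act G) (CAct G) <- pre_steps [::] h],
   [ffun i => if teamof G h i then None else Some (obs G i h)]).
Arguments advinfo : clear implicits.

(* pure strategy of i^+ (acts for player i where t_i = MAX) *)
Definition maxpure (G : hrg) := infoT G -> Act G.
Definition max_legal (G : hrg) (i : 'I_(np G)) (s : maxpure G) : Prop :=
  forall h : hist G, valid G h -> ~~ terminal G h -> teamof G h i ->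
    legal G h i (s (infostate G i h)).
Arguments max_legal : clear implicits.

(* pure strategy of the adversary (acts for all players i with t_i = MIN) *)
Definition advpure (G : hrg) := advinfoT G -> {ffun 'I_(np G) -> Act G}.
Definition adv_legal (G : hrg) (s : advpure G) : Prop :=
  forall h : hist G, valid G h -> ~~ terminal G h -> forall i, ~~ teamof G h i ->
    legal G h i (s (advinfo G h) i).
Arguments adv_legal : clear implicits.

Record mixed (T : Type) (ok : T -> Prop) := Mixed {
  msz : nat;
  mw : 'I_msz -> R;
  mp : 'I_msz -> T;
  mw_ge0 : forall k, 0 <= mw k;
  mw_sum1 : \sum_k mw k = 1;
  mp_ok : forall k, ok (mp k) }.

Fixpoint play (G : hrg) (sg : 'I_(np G) -> maxpure G) (tau : advpure G)
    (k : nat) (h : hist G) : R :=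
  if terminal G h then util G h else
  if k is k'.+1 then
    \sum_(c : CAct G) chance G h c *
       @play G sg tau k'
         (rcons h ([ffun i => if teamof G h i then sg i (infostate G i h)
                              else tau (advinfo G h) i], c))
  else 0.
Arguments play : clear implicits.

Definition payoff (G : hrg) (x : forall i, mixed (max_legal G i))
    (y : mixed (@adv_legal G)) : R :=
  \sum_(J : {dffun forall i : 'I_(np G), 'I_(msz (x i))})
   \sum_(k : 'I_(msz y))
     ((\prod_i mw (x i) (J i)) * mw y k) *
       play G (fun i => mp (x i) (J i)) (mp y k) (depth G) [::].
Arguments payoff : clear implicits.

Definition value (G : hrg) (x : forall i, mixed (max_legal G i)) : R :=
  inf (range (payoff G x)).
Arguments value : clear implicits.

Definition tme (G : hrg) : R := sup (range (value G)).

(* a message action: public message and private messages (None = bot) *)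
Definition MsgT (n M : nat) := ('I_M * {ffun 'I_n -> option 'I_M})%type.
(* what a player sees after a communication round: all public messages,
   the private messages addressed to it, and which pairs (i,l) communicated *)
Definition MV (n M : nat) :=
  ({ffun 'I_n -> option 'I_M} * {ffun 'I_n -> option 'I_M} * {ffun 'I_n * 'I_n -> bool})%type.

Definition proj_joint (n : nat) (A : finType) (B : Type) (f : {ffun 'I_n -> A + B})
  : option {ffun 'I_n -> A} :=
  if [pick a : A] is Some a0 then
    if [forall i, if f i is inl _ then true else false]
    then Some [ffun i => if f i is inl a then a else a0] else None
  else None.

Section Comm.
Variables (G : hrg) (M K : nat).
Local Notation n := (np G).
Local Notation cstep := (stepT n (Act G + MsgT n M) (option (CAct G))).

(* parse a history of the extension into (underlying history h of G, number r
   of communication rounds already played at the current step of G) *)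
Definition parse_step (acc : option (hist G * nat)) (s : cstep)
  : option (hist G * nat) :=
  match acc with
  | None => None
  | Some (h, r) =>
      match s.2 with
      | Some c => if @proj_joint _ _ _ s.1 is Some a then Some (rcons h (a, c), 0%N) else None
      | None => Some (h, r.+1)
      end
  end.
Definition parse (h' : seq cstep) : option (hist G * nat) :=
  foldl parse_step (Some ([::], 0%N)) h'.

Definition game_node (h : hist G) (r : nat) := (size h == 0%N) || (r == K).

Definition clegal (h' : seq cstep) (i : 'I_n) (a : Act G + MsgT n M) : bool :=
  if parse h' is Some (h, r) then
    ~~ terminal G h &&
    (if game_node h r then (if a is inl b then legal G h i b else false)
     else if (r < K)%N then (if a is inr m then m.2 i == None else false)
     else false)
  else false.

Definition cchance (h' : seq cstep) (oc : option (CAct G)) : R :=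
  if parse h' is Some (h, r) then
    (if game_node h r then (if oc is Some c then chance G h c else 0)
     else (if oc is None then 1 else 0))
  else 0.

Definition cterminal (h' : seq cstep) : bool :=
  if parse h' is Some (h, _) then terminal G h else true.

Definition msgview (i : 'I_n) (s : cstep) : MV n M :=
  ([ffun j => if s.1 j is inr m then Some m.1 else None],
   [ffun j => if s.1 j is inr m then m.2 i else None],
   [ffun p : 'I_n * 'I_n => if s.1 p.1 is inr m then m.2 p.2 != None else false]).

Definition cobs (i : 'I_n) (h' : seq cstep) : (Obs G + MV n M)%type :=
  if parse h' is Some (h, O) then inl (obs G i h)
  else inr (if ohead (rev h') is Some s then msgview i s
            else ([ffun _ => None], [ffun _ => None], [ffun _ => false])).

Definition cteam (oc : option (CAct G)) : 'I_n -> bool :=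
  if oc is Some c then team G c else fun _ => true.

Definition cutil (h' : seq cstep) : R :=
  if parse h' is Some (h, _) then util G h else 0.

(* Communication rounds happen at every nonroot nonterminal history of G
   (the root is a pure chance move, before the teams exist). *)
Definition Comm : hrg :=
  @HRG n (Act G + MsgT n M)%type (option (CAct G)) (Obs G + MV n M)%type
    clegal cchance cterminal cobs (depth G * K.+1)%N cteam cutil (mediator G).

End Comm.

Definition CVal_priv (G : hrg) : R :=
  sup [set v | exists M K : nat, [/\ (0 < M)%N, (0 < K)%N & v = tme (Comm G M K)]].

Definition obs_encoding (G : hrg) (M : nat) (encO : 'I_(np G) -> Obs G -> 'I_M) : Prop :=
  forall i (h1 h2 : hist G), valid G h1 -> valid G h2 ->
    ~~ terminal G h1 -> ~~ terminal G h2 -> (0 < size h1)%N -> (0 < size h2)%N ->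
    encO i (obs G i h1) = encO i (obs G i h2) -> obs G i h1 = obs G i h2.

Definition act_decoding (G : hrg) (M : nat) (dec : 'I_(np G) -> Obs G -> 'I_M -> Act G)
  : Prop :=
  forall i (h : hist G), valid G h -> ~~ terminal G h -> (0 < size h)%N ->
    (forall m, legal G h i (dec i (obs G i h) m)) /\
    (forall a, legal G h i a -> exists m, dec i (obs G i h) m = a).

(* pure strategy s of player i^+ in CSplit(Comm^{M,K}_priv(G)) follows the
   protocol at every step h (nonroot, nonterminal) of G where t_i = MAX:
   round 1: non-mediator MAX players privately send their (encoded)
            observation to the mediator, nothing else;
   round 2: the mediator privately sends a recommendation to every other
            player, nothing else; the others send nothing;
   rounds 3..K: nothing is sent;
   action: every non-mediator MAX player plays the action recommended to it.
   ("nothing" = bot for private messages, message 0 for the public channel) *)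
Definition follows_protocol (G : hrg) (M K : nat)
    (encO : 'I_(np G) -> Obs G -> 'I_M) (dec : 'I_(np G) -> Obs G -> 'I_M -> Act G)
    (i : 'I_(np G)) (s : maxpure (Comm G M K)) : Prop :=
  let med := mediator G in
  forall h' : hist (Comm G M K),
    valid (Comm G M K) h' -> ~~ terminal (Comm G M K) h' -> teamof (Comm G M K) h' i ->
  forall (h : hist G) (r : nat), @parse G M h' = Some (h, r) -> (0 < size h)%N ->
  let a : (Act G + MsgT (np G) M)%type := s (infostate (Comm G M K) i h') in
  [/\ (r = 0%N -> exists m : MsgT (np G) M, a = inr m /\ (m.1 : nat) = 0%N /\
         m.2 = [ffun j => if (i != med) && (j == med)
                          then Some (encO i (obs G i h)) else None]),
      (r = 1%N -> exists m : MsgT (np G) M, a = inr m /\ (m.1 : nat) = 0%N /\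
         (forall j, (m.2 j == None) = (i != med) || (j == med))),
      ((2 <= r < K)%N -> exists m : MsgT (np G) M, a = inr m /\ (m.1 : nat) = 0%N /\
         m.2 = [ffun _ => None]) &
      (r = K -> i != med ->
         forall s2 mm, ohead (drop (size h' - K + 1)%N h') = Some s2 ->
         (if s2.1 med is inr m then m.2 i else None) = Some mm ->
         a = inl (dec i (obs G i h) mm))].

End Games.

Arguments valid {R} G h.
Arguments teamof {R} G h _.
Arguments infostate {R} G i h.
Arguments advinfo {R} G h.
Arguments max_legal {R} G i s.
Arguments adv_legal {R} G s.
Arguments play {R} G sg tau k h.
Arguments payoff {R} G x y.
Arguments value {R} G x.
Arguments follows_protocol {R} G M K encO dec i s.
Arguments parse {R} G M h'.

(* Main.v *)
Require Import Defs.
From HB Require Import structures.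
From mathcomp Require Import all_boot all_order all_algebra.
From mathcomp Require Import boolp classical_sets reals topology normedtype derive.
From mathcomp Require Import zify.
Set Implicit Arguments. Unset Strict Implicit. Unset Printing Implicit Defensive.
Import Order.TTheory GRing.Theory Num.Theory.
Import numFieldNormedType.Exports.

(** Revelation principle.  Fix any number M' of messages and K' of rounds and any
    MAX profile x' of the corresponding extension.  In the protocol the mediator
    draws one pure strategy for every player from x' and lets these strategies play
    the extension "in its head" on the observations reported to it, recommending the
    actions they end up with.  A pure adversary tau against this protocol is matched
    by the adversary against x' who draws the strategies of the MIN players from x'
    itself, feeds them the observations that tau makes these players report, and
    shows tau the resulting recommendations.  As the MAX and the MIN parts of two
    independent draws of x' form one draw of x', both yield the same payoff; hence
    some protocol profile is worth at least the value of x'.  Protocol profiles are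
    parametrized, up to payoff equivalence, by a mixture over finitely many mediator
    strategies; the guaranteed payoff is continuous in the mixture, so it is
    maximized by some mixture, whose value is therefore CVal. *)

(** * Games and their communication extensions *)

Lemma pre_steps_rcons (S : Type) (acc h : seq S) (s : S) :
  pre_steps acc (rcons h s) = rcons (pre_steps acc h) (acc ++ h, s).
Proof.
elim: h acc => [|x h IH] acc /=; first by rewrite cats0.
by rewrite IH cat_rcons.
Qed.

Section Generic.
Variables (R : realType) (G : hrg R).
Implicit Types (h : hist G) (s : stepT (np G) (Act G) (CAct G)).

Lemma valid_rcons h s : valid G (rcons h s) =
  [&& valid G h, ~~ terminal G h, [forall i, legal G h i (s.1 i)]
    & (0 < chance G h s.2)%R].
Proof. by rewrite /valid pre_steps_rcons all_rcons /= andbC. Qed.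

Lemma infostate_rcons i h s : infostate G i (rcons h s) =
  (rcons (infostate G i h).1 ((infostate G i h).2, s.1 i), obs G i (rcons h s)).
Proof. by rewrite /infostate pre_steps_rcons map_rcons. Qed.

Lemma advinfo_rcons h s : advinfo G (rcons h s) =
  (rcons (advinfo G h).1
     [ffun i => omap (fun o => (o, s.1 i)) ((advinfo G h).2 i)],
   [ffun i => if teamof G (rcons h s) i then None
              else Some (obs G i (rcons h s))]).
Proof.
rewrite /advinfo pre_steps_rcons map_rcons /=; congr (rcons _ _, _).
by apply/ffunP => i; rewrite !ffunE; case: (teamof _ _ _).
Qed.

Lemma teamof_rcons h s : h != [::] -> teamof G (rcons h s) = teamof G h.
Proof. by case: h. Qed.

(** Observations without the player's own actions: position [p] holds the observation made at the
    prefix of length [p], so a strategy can address any earlier round by position. *)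
Definition obslist (i : 'I_(np G)) (h : hist G) : seq (Obs G) :=
  rcons (unzip1 (infostate G i h).1) (obs G i h).

Lemma obslist_rcons i h s :
  obslist i (rcons h s) = rcons (obslist i h) (obs G i (rcons h s)).
Proof. by rewrite /obslist infostate_rcons /unzip1 map_rcons. Qed.

Lemma size_obslist i h : size (obslist i h) = (size h).+1.
Proof.
elim/last_ind: h => [//|h s IH].
by rewrite obslist_rcons size_rcons IH size_rcons.
Qed.

Lemma size_infostate i h : size (infostate G i h).1 = size h.
Proof. by have := size_obslist i h; rewrite size_rcons size_map => -[]. Qed.

Lemma nth_obslist i h1 h2 x0 : nth x0 (obslist i (h1 ++ h2)) (size h1) = obs G i h1.
Proof.
elim/last_ind: h2 => [|h2 s IH]; first by rewrite cats0 nth_rcons size_map size_infostate ltnn eqxx.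
rewrite -rcons_cat obslist_rcons nth_rcons size_obslist size_cat.
by rewrite ltnS leq_addr.
Qed.

Definition joint_act (sg : 'I_(np G) -> maxpure G) (tau : advpure G) (h : hist G) :
    {ffun 'I_(np G) -> Act G} :=
  [ffun i => if teamof G h i then sg i (infostate G i h) else tau (advinfo G h) i].

Lemma joint_act_legal sg tau h i : (forall i, max_legal G i (sg i)) -> adv_legal G tau ->
  valid G h -> ~~ terminal G h -> legal G h i (joint_act sg tau h i).
Proof.
move=> sg_ok tau_ok vh nt; rewrite ffunE.
case: ifP => t; first exact: sg_ok.
by apply: tau_ok => //; rewrite t.
Qed.

Lemma playE sg tau k h : ~~ terminal G h -> play G sg tau k.+1 h =
  (\sum_(c : CAct G) chance G h c * play G sg tau k (rcons h (joint_act sg tau h, c)))%R.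
Proof. by move=> nt /=; rewrite (negPf nt). Qed.

Lemma play_terminal sg tau k h : terminal G h -> play G sg tau k h = util G h.
Proof. by case: k => [|k] /= ->. Qed.

End Generic.

(** * Axioms of a mediated game, and forcing actions to be legal *)

Section Mediated.
Variables (R : realType) (G : hrg R).
Hypothesis medG : mediated_hrg G.
Implicit Types h : hist G.

Lemma hrg_legal h i : valid G h -> ~~ terminal G h -> exists a, legal G h i a.
Proof. by case: medG => H _ vh nt; exact: H. Qed.

Lemma hrg_chance_ge0 h c : valid G h -> ~~ terminal G h -> (0 <= chance G h c)%R.
Proof. by case: medG => _ [H _] vh nt; case: (H h vh nt) => + _; apply. Qed.

Lemma hrg_chance_sum h : valid G h -> ~~ terminal G h -> (\sum_c chance G h c = 1)%R.
Proof. by case: medG => _ [H _] vh nt; case: (H h vh nt). Qed.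

Lemma hrg_depth h : valid G h -> size h = depth G -> terminal G h.
Proof. by case: medG => _ [_] [H _]; exact: H. Qed.

Lemma hrg_obs i h1 h2 : valid G h1 -> valid G h2 -> ~~ terminal G h1 ->
  ~~ terminal G h2 -> obs G i h1 = obs G i h2 -> legal G h1 i =1 legal G h2 i.
Proof. by case: medG => _ [_] [_] [H _]; exact: H. Qed.

Lemma hrg_root : ~~ terminal G [::].
Proof. by case: medG => _ [_] [_] [_] [[]]. Qed.

Lemma hrg_root_uniq i a b : legal G [::] i a -> legal G [::] i b -> a = b.
Proof.
case: medG => _ [_] [_] [_] [[_ H] _] la lb.
have /mem_card1[x xP] := H i.
by have := xP a; have := xP b; rewrite !inE la lb => /esym/eqP -> /esym/eqP ->.
Qed.

Lemma valid_nil : valid G [::]. Proof. by []. Qed.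

Lemma teamof_mediator h : valid G h -> teamof G h (mediator G).
Proof.
case: medG => _ [_] [_] [_] [_] [_ H].
case: h => [//|s h]; rewrite /valid /= => /andP[/and3P[_ _ c0] _].
exact: H.
Qed.

Lemma valid_size h : valid G h -> (size h <= depth G)%N.
Proof.
elim/last_ind: h => [//|h s IH]; rewrite valid_rcons size_rcons => /and4P[vh nt _ _].
rewrite ltn_neqAle IH // andbT; apply: contraNneq nt => e.
exact: hrg_depth.
Qed.

Lemma valid_size_lt h : valid G h -> ~~ terminal G h -> (size h < depth G)%N.
Proof.
move=> vh nt; rewrite ltn_neqAle valid_size // andbT.
by apply: contraNneq nt => e; exact: hrg_depth.
Qed.

Lemma chance_pos_ex h : valid G h -> ~~ terminal G h -> exists c, (0 < chance G h c)%R.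
Proof.
move=> vh nt; case: (pselect (exists c, (0 < chance G h c)%R)) => // nex.
have := hrg_chance_sum vh nt; rewrite big1 => [/esym/eqP|c _]; first by rewrite oner_eq0.
apply/eqP; rewrite eq_le hrg_chance_ge0 // andbT leNgt; apply/negP => c0.
by apply: nex; exists c.
Qed.

(** Legality as a function of the observation alone, which is sound because equal observations at
    valid nonterminal histories have equal legal actions. *)
Definition obs_legal (i : 'I_(np G)) (o : Obs G) (a : Act G) : bool :=
  `[< exists h, [/\ valid G h, ~~ terminal G h, obs G i h = o & legal G h i a] >].

Lemma obs_legalE h i : valid G h -> ~~ terminal G h ->
  obs_legal i (obs G i h) =1 legal G h i.
Proof.
move=> vh nt a; apply/asboolP/idP => [[h1 [v1 n1 e l]]|l]; last by exists h.
by rewrite -(hrg_obs v1 vh n1 nt e).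
Qed.

Lemma root_act_ex (i : 'I_(np G)) : exists a, legal G [::] i a.
Proof. exact: hrg_legal valid_nil hrg_root. Qed.

Definition root_act (i : 'I_(np G)) : Act G := projT1 (cid (root_act_ex i)).

Lemma root_actP i : legal G [::] i (root_act i).
Proof. exact: (projT2 (cid (root_act_ex i))). Qed.

Definition safe_act (i : 'I_(np G)) (o : Obs G) (a : Act G) : Act G :=
  if obs_legal i o a then a else odflt a [pick b | obs_legal i o b].

Lemma safe_act_legal h i a : valid G h -> ~~ terminal G h ->
  legal G h i (safe_act i (obs G i h) a).
Proof.
move=> vh nt; rewrite -obs_legalE // /safe_act; case: ifP => // _.
case: pickP => [b //|no] /=; have [b lb] := hrg_legal i vh nt.
by have := no b; rewrite obs_legalE // lb.
Qed.

Lemma safe_act_id h i a : valid G h -> ~~ terminal G h -> legal G h i a ->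
  safe_act i (obs G i h) a = a.
Proof. by move=> vh nt la; rewrite /safe_act obs_legalE // la. Qed.

End Mediated.

Lemma proj_joint_inl (n : nat) (A : finType) (B : Type) (a : {ffun 'I_n -> A}) (x : A) :
  proj_joint A (B := B) [ffun i => inl (a i)] = Some a.
Proof.
rewrite /proj_joint; case: pickP => [a0 _|/(_ x)//].
have -> : [forall i, if [ffun j => inl (a j) : A + B] i is inl _ then true else false].
  by apply/forallP => i; rewrite ffunE.
by congr Some; apply/ffunP => i; rewrite !ffunE.
Qed.

(** * Shape of the reachable histories of an extension *)

Section CommFacts.
Variables (R : realType) (G : hrg R) (M K : nat).
Hypothesis medG : mediated_hrg G.
Local Notation C := (Comm G M K).
Local Notation n := (np G).

Lemma parse_rcons (h' : hist C) s : Defs.parse G M (rcons h' s) = parse_step (Defs.parse G M h') s.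
Proof. by rewrite /Defs.parse foldl_rcons. Qed.

(** The reachable history [h'] stands in round [r] of the step of [G] at [h]. The length formula
    reflects that the root step takes one move and every later step [K] rounds and one game move. *)
Record at_node (h' : hist C) (h : hist G) (r : nat) : Prop := AtNode {
  an_parse : Defs.parse G M h' = Some (h, r);
  an_valid' : valid C h';
  an_valid : valid G h;
  an_r : (r <= K)%N;
  an_nil : h = [::] -> h' = [::] /\ r = 0%N;
  an_size : h != [::] -> size h' = ((size h).-1 * K.+1 + r).+1;
  an_team : teamof C h' = teamof G h }.

Lemma at_node_game h' h r s (a : {ffun 'I_n -> Act G}) c :
  at_node h' h r -> game_node K h r -> ~~ terminal G h ->
  s = ([ffun i => inl (a i)], Some c) -> (forall i, legal G h i (a i)) ->
  (0 < chance G h c)%R -> at_node (rcons h' s) (rcons h (a, c)) 0.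
Proof.
move=> an gn nt -> la c0; have [p v' v rK hnil hsz ht] := an.
split => //.
- by rewrite parse_rcons p /= (proj_joint_inl _ _ (a (mediator G))).
- rewrite valid_rcons v' /= /cterminal p nt /= /clegal p nt gn /= /cchance p gn c0 andbT.
  by apply/forallP => i; rewrite ffunE.
- by rewrite valid_rcons v nt c0 andbT; apply/forallP.
- by case: (h) .
- move=> _; rewrite !size_rcons /= addn0; case: (eqVneq h [::]) => [h0|h0].
    by have [-> _] := hnil h0; rewrite h0.
  rewrite hsz //; move: gn; rewrite /game_node size_eq0 (negPf h0) /= => /eqP ->.
  by case: (h) h0 => [//|? l] _ /=; rewrite mulSn; lia.
- case: (eqVneq h [::]) => [h0|h0]; first by have [-> _] := hnil h0; rewrite h0.
  have h'0 : h' != [::] by apply: contraNneq h0 => e; move: p; rewrite e /Defs.parse /= => -[->].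
  by rewrite !teamof_rcons.
Qed.

Lemma at_node_comm h' h r (m : {ffun 'I_n -> MsgT n M}) : at_node h' h r ->
  h != [::] -> (r < K)%N -> ~~ terminal G h -> (forall i, (m i).2 i = None) ->
  at_node (rcons h' ([ffun i => inr (m i)], None)) h r.+1.
Proof.
move=> an h0 rK nt lm; have [p v' v _ hnil hsz ht] := an.
have gn : game_node K h r = false by rewrite /game_node size_eq0 (negPf h0) /= ltn_eqF.
split => //.
- by rewrite parse_rcons p /=.
- rewrite valid_rcons v' /= /cterminal p nt /= /clegal p nt gn rK /= /cchance p gn ltr01 andbT.
  by apply/forallP => i; rewrite ffunE lm.
- by move=> e; rewrite e in h0.
- by move=> _; rewrite size_rcons hsz // addnS.
- by rewrite teamof_rcons //; apply: contraNneq h0 => e; move: p; rewrite e /Defs.parse /= => -[->].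
Qed.

Lemma comm_legal_game h' h r i (b : Act C) : at_node h' h r -> game_node K h r ->
  legal C h' i b -> exists2 a, b = inl a & legal G h i a.
Proof.
move=> an gn; rewrite /= /clegal (an_parse an) gn => /andP[_].
by case: b => // a la; exists a.
Qed.

Lemma comm_legal_comm h' h r i (b : Act C) : at_node h' h r -> ~~ game_node K h r ->
  legal C h' i b -> exists2 m, b = inr m & m.2 i = None.
Proof.
move=> an gn; rewrite /= /clegal (an_parse an) (negPf gn) => /andP[_].
by case: ifP => // _; case: b => // m /eqP ?; exists m.
Qed.

Lemma not_game_node (h : hist G) r : (r <= K)%N -> ~~ game_node K h r = (h != [::]) && (r < K)%N.
Proof. by move=> rK; rewrite /game_node negb_or size_eq0 ltn_neqAle rK andbT. Qed.

Lemma all_inl (A B : finType) (P : 'I_n -> A -> Prop) (f : {ffun 'I_n -> A + B}) :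
  (forall i, exists2 a, f i = inl a & P i a) ->
  exists2 a : {ffun 'I_n -> A}, f = [ffun i => inl (a i)] & forall i, P i (a i).
Proof.
move=> H; exists [ffun i => projT1 (cid2 (H i))].
  by apply/ffunP => i; rewrite !ffunE; case: (cid2 _).
by move=> i; rewrite ffunE; case: (cid2 _).
Qed.

Lemma all_inr (A B : finType) (P : 'I_n -> B -> Prop) (f : {ffun 'I_n -> A + B}) :
  (forall i, exists2 a, f i = inr a & P i a) ->
  exists2 a : {ffun 'I_n -> B}, f = [ffun i => inr (a i)] & forall i, P i (a i).
Proof.
move=> H; exists [ffun i => projT1 (cid2 (H i))].
  by apply/ffunP => i; rewrite !ffunE; case: (cid2 _).
by move=> i; rewrite ffunE; case: (cid2 _).
Qed.

(** Positive chance probability decides between [Some] and [None], legality between [inl] and [inr],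
    both according to [game_node]. So a valid history grows only by a joint game move or by a full
    round of messages. *)
Lemma at_node_ex (h' : hist C) : valid C h' -> exists h r, at_node h' h r.
Proof.
elim/last_ind: h' => [_|h' s IH]; first by exists [::], 0%N; split.
rewrite valid_rcons => /and4P[v' nt' /forallP l c0].
have [h [r an]] := IH v'.
have nt : ~~ terminal G h by move: nt'; rewrite /= /cterminal (an_parse an).
case: (boolP (game_node K h r)) => gn.
  have [a ea la] := all_inl (fun i => comm_legal_game an gn (l i)).
  move: c0; rewrite /= /cchance (an_parse an) gn.
  case: s ea l => s1 [c|] /= ea l c0; last by rewrite ltxx in c0.
  exists (rcons h (a, c)), 0%N; apply: (at_node_game an gn nt) => //.
  by rewrite ea.
have [m em lm] := all_inr (fun i => comm_legal_comm an gn (l i)).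
move: c0; rewrite /= /cchance (an_parse an) (negPf gn).
case: s em l => s1 [c|] /= em l c0; first by rewrite ltxx in c0.
move: gn; rewrite not_game_node ?(an_r an) // => /andP[h0 rK].
exists h, r.+1; rewrite em; exact: at_node_comm.
Qed.

Lemma at_node_parse h' h r : valid C h' -> Defs.parse G M h' = Some (h, r) -> at_node h' h r.
Proof. by move=> /at_node_ex[h1 [r1 an]]; rewrite (an_parse an) => -[<- <-]. Qed.

Lemma at_node_terminal h' h r : at_node h' h r -> terminal C h' = terminal G h.
Proof. by move=> an; rewrite /= /cterminal (an_parse an). Qed.

Lemma at_node_nonnil h' h r : at_node h' h r -> (h' == [::]) = (h == [::]).
Proof.
move=> an; apply/eqP/eqP => [e|/(an_nil an)[] //].
by move: (an_parse an); rewrite e /Defs.parse /= => -[->].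
Qed.

Lemma at_node_nil : at_node [::] [::] 0. Proof. by split. Qed.

Lemma at_node_obs0 h' h i : at_node h' h 0 -> obs C i h' = inl (obs G i h).
Proof. by move=> an; rewrite /= /cobs (an_parse an). Qed.

Lemma at_node_obsS h' h r i s : at_node (rcons h' s) h r.+1 ->
  obs C i (rcons h' s) = inr (msgview G i s).
Proof. by move=> an; rewrite /= /cobs (an_parse an) rev_rcons. Qed.

(** The removed steps are all communication rounds of the current step, so the underlying history of
    [G] stays the same. *)
Lemma at_node_take h' h r r0 : at_node h' h r -> (r0 <= r)%N ->
  at_node (take (size h' - (r - r0)) h') h r0.
Proof.
elim: r h' => [|r IH] h' an; first by rewrite leqn0 => /eqP ->; rewrite subnn subn0 take_size.
rewrite leq_eqVlt => /predU1P[->|]; first by rewrite subnn subn0 take_size.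
rewrite ltnS => le; case/lastP: h' an => [|h1 s] an; first by have [] := an_parse an.
have : valid C h1 by have := an_valid' an; rewrite valid_rcons => /and4P[].
move=> /at_node_ex[h2 [r2 an2]].
have := an_parse an; rewrite parse_rcons (an_parse an2) /=.
case: s.2 => [c|]; first by case: proj_joint.
move=> [e2 er]; subst h2 r2; have := IH _ an2 le.
rewrite size_rcons -cats1 takel_cat; last by lia.
by have -> : ((size h1).+1 - (r.+1 - r0) = size h1 - (r - r0))%N by lia.
Qed.

(* sz is the length of a history of C: after the root step, every step of G takes
   K+1 steps of C. *)
Definition rnd (sz : nat) : nat := sz.-1 %% K.+1.
Definition is_game (sz : nat) : bool := (sz == 0%N) || (rnd sz == K).

Lemma rnd_at h' h r : at_node h' h r -> rnd (size h') = r.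
Proof.
move=> an; case: (eqVneq h [::]) => h0; first by have [-> ->] := an_nil an h0; rewrite /rnd mod0n.
by rewrite /rnd (an_size an h0) /= modnMDl modn_small // ltnS (an_r an).
Qed.

Lemma is_game_at h' h r : at_node h' h r -> is_game (size h') = game_node K h r.
Proof.
move=> an.
by rewrite /is_game (rnd_at an) size_eq0 (at_node_nonnil an) /game_node size_eq0.
Qed.

(** The latest observation coming from [G]: it lies as many positions back as rounds have been
    played in the current step, a number that the length of [l] reveals. *)
Definition cur_obs (i : 'I_n) (l : seq (Obs C)) : Obs G :=
  if nth (inl (obs G i [::])) l ((size l).-1 - rnd (size l).-1) is inl o then o
  else obs G i [::].

Lemma nth_obslist_at h' h r r0 i x0 : at_node h' h r -> (r0 <= r)%N ->
  nth x0 (obslist (G := C) i h') (size h' - (r - r0)) = obs C i (take (size h' - (r - r0)) h').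
Proof.
move=> an le; rewrite -{1}(cat_take_drop (size h' - (r - r0)) h').
by rewrite -{3}(size_takel (leq_subr (r - r0) (size h'))) nth_obslist.
Qed.

Lemma cur_obs_at h' h r i : at_node h' h r -> cur_obs i (obslist (G := C) i h') = obs G i h.
Proof.
move=> an; rewrite /cur_obs size_obslist /= (rnd_at an).
have := nth_obslist_at i (inl (obs G i [::])) an (leq0n r).
by have := at_node_obs0 i (at_node_take an (leq0n r)); rewrite !subn0 => -> ->.
Qed.

Variable z0 : 'I_M.
Definition silent : MsgT n M := (z0, [ffun _ => None]).

(* Forces an action b chosen after the observations l into a legal one; legal
   actions are unchanged. *)
Definition san (i : 'I_n) (l : seq (Obs C)) (b : Act C) : Act C :=
  if is_game (size l).-1
  then inl (safe_act i (cur_obs i l) (if b is inl a then a else root_act medG i))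
  else if b is inr m then if m.2 i == None then b else inr silent else inr silent.

Lemma san_comm i l b : ~~ is_game (size l).-1 ->
  exists2 m : MsgT n M, san i l b = inr m & m.2 i = None.
Proof.
rewrite /san => /negPf ->; case: b => [a|m]; first by exists silent; rewrite ?ffunE.
by case: eqP => e; [exists m | exists silent; rewrite ?ffunE].
Qed.

Lemma san_comm_id i l (m : MsgT n M) : ~~ is_game (size l).-1 -> m.2 i = None ->
  san i l (inr m) = inr m.
Proof. by rewrite /san => /negPf -> ->. Qed.

Lemma san_legal h' i b : valid C h' -> ~~ terminal C h' ->
  legal C h' i (san i (obslist (G := C) i h') b).
Proof.
move=> /at_node_ex[h [r an]]; rewrite (at_node_terminal an) => nt.
have l : is_game (size (obslist (G := C) i h')).-1 = game_node K h r.
  by rewrite size_obslist /= (is_game_at an).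
rewrite /= /clegal (an_parse an) nt /=; case: ifP => gn; last first.
  have rK : (r < K)%N.
    by have := not_game_node h (an_r an); rewrite gn => /esym/andP[].
  rewrite rK; have [|m -> ->] := @san_comm i (obslist (G := C) i h') b; by rewrite ?l ?gn.
rewrite /san l gn (cur_obs_at _ an); exact: safe_act_legal (an_valid an) nt.
Qed.

Lemma san_id h' i b : valid C h' -> ~~ terminal C h' -> legal C h' i b ->
  san i (obslist (G := C) i h') b = b.
Proof.
move=> /at_node_ex[h [r an]]; rewrite (at_node_terminal an) => nt lb.
have l : is_game (size (obslist (G := C) i h')).-1 = game_node K h r.
  by rewrite size_obslist /= (is_game_at an).
case: (boolP (game_node K h r)) => gn.
  have [a -> la] := comm_legal_game an gn lb.
  by rewrite /san l gn (cur_obs_at _ an) safe_act_id // (an_valid an).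
have [m -> lm] := comm_legal_comm an gn lb.
by rewrite san_comm_id // l.
Qed.

(** * Play through the communication rounds of one step *)

Section Run.
Variables (sg : 'I_n -> maxpure C) (tau : advpure C).
Hypothesis sg_ok : forall i, max_legal C i (sg i).
Hypothesis tau_ok : adv_legal C tau.
Local Notation nxt := (joint_act (G := C) sg tau).

Definition comm_run (r : nat) (h' : hist C) : hist C :=
  iter r (fun h' => rcons h' (nxt h', None)) h'.

Lemma joint_act_comm h' h r : at_node h' h r -> h != [::] -> (r < K)%N -> ~~ terminal G h ->
  exists2 m : {ffun 'I_n -> MsgT n M}, nxt h' = [ffun i => inr (m i)] & forall i, (m i).2 i = None.
Proof.
move=> an h0 rK nt; apply: (all_inr (P := fun i (m : MsgT n M) => m.2 i = None)) => i.
apply: (comm_legal_comm an); first by rewrite not_game_node ?h0 ?(an_r an).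
by apply: joint_act_legal => //; [exact: an_valid' an | rewrite (at_node_terminal an)].
Qed.

Lemma joint_act_game h' h r : at_node h' h r -> game_node K h r -> ~~ terminal G h ->
  exists2 a : {ffun 'I_n -> Act G}, nxt h' = [ffun i => inl (a i)] & forall i, legal G h i (a i).
Proof.
move=> an gn nt; apply: (all_inl (P := fun i a => legal G h i a)) => i.
apply: (comm_legal_game an gn).
by apply: joint_act_legal => //; [exact: an_valid' an | rewrite (at_node_terminal an)].
Qed.

Lemma at_node_run h' h r : at_node h' h 0 -> h != [::] -> (r <= K)%N -> ~~ terminal G h ->
  at_node (comm_run r h') h r.
Proof.
move=> an h0 + nt; elim: r => [//|r IH] rK /=.
have {}IH := IH (ltnW rK).
by have [m -> lm] := joint_act_comm IH h0 rK nt; exact: at_node_comm.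
Qed.

(** In a communication round chance plays [None] with probability 1, so pure strategies pass through
    the rounds deterministically. *)
Lemma play_comm_run h' h r k : at_node h' h 0 -> h != [::] -> (r <= K)%N -> ~~ terminal G h ->
  play C sg tau (r + k) h' = play C sg tau k (comm_run r h').
Proof.
move=> an h0 + nt; elim: r k => [//|r IH] k rK.
rewrite addSnnS IH ?(ltnW rK) //.
have ar := at_node_run an h0 (ltnW rK) nt.
have gn : game_node K h r = false by apply/negbTE; rewrite not_game_node ?h0 // ltnW.
rewrite playE ?(at_node_terminal ar) // (bigD1 None) //= /cchance (an_parse ar) gn mul1r.
by rewrite big1 ?addr0 // => -[c|] // _; rewrite mul0r.
Qed.

Lemma play_game h' h r k : at_node h' h r -> game_node K h r -> ~~ terminal G h ->
  (play C sg tau k.+1 h' =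
   \sum_c chance G h c * play C sg tau k (rcons h' (nxt h', Some c)))%R.
Proof.
move=> an gn nt; rewrite playE ?(at_node_terminal an) // (bigD1 None) //=.
rewrite {1}/cchance (an_parse an) gn mul0r add0r (reindex_omap Some id) => [|[c|]//].
apply: eq_big => [c|c _]; first by rewrite /= eqxx.
by rewrite /cchance (an_parse an) gn.
Qed.

End Run.
End CommFacts.

(** * The mediator protocol *)

Section Protocol.
Variables (R : realType) (G : hrg R) (M K : nat).
Hypothesis medG : mediated_hrg G.
Hypothesis K_gt1 : (1 < K)%N.
Variable z0 : 'I_M.
Variables (encO : 'I_(np G) -> Obs G -> 'I_M)
  (dec : 'I_(np G) -> Obs G -> 'I_M -> Act G).
Hypothesis decP : act_decoding G dec.
Local Notation C := (Comm G M K).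
Local Notation n := (np G).
Local Notation med := (mediator G).
Local Notation at_node := (@at_node R G M K).
Local Notation olist i h := (obslist (G := C) i h).

Definition reportT := {ffun 'I_n -> option 'I_M}.
Definition mediatorT := seq reportT -> {ffun 'I_n -> 'I_M}.

Definition private_msg (v : Obs C) : reportT := if v is inr w then w.1.2 else [ffun _ => None].

(** [o] is the mediator's observation at the start of a step and [v] its view after the report
    round. The mediator sends itself nothing, so its own entry is computed from [o]. *)
Definition report (o v : Obs C) : reportT :=
  [ffun i => if i == med then if o is inl o' then Some (encO med o') else None
             else private_msg v i].

Definition nth_obs (l : seq (Obs C)) (p : nat) : Obs C := nth (inl (obs G med [::])) l p.

(** The nonroot step number [j], counted from 0, starts at position [j * K.+1 + 1]; its reports
    become visible one position later. *)
Definition reports_upto (l : seq (Obs C)) (q : nat) : seq reportT :=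
  [seq report (nth_obs l (j * K.+1).+1) (nth_obs l (j * K.+1).+2) | j <- iota 0 q].

Definition reports (l : seq (Obs C)) : seq reportT :=
  reports_upto l ((size l).-1.-1 %/ K.+1).+1.

(** Meant for the game move, when the current step began [K] positions ago; the recommendation, sent
    in round 1, is visible two positions after that beginning. *)
Definition received (l : seq (Obs C)) : option 'I_M :=
  private_msg (nth_obs l ((size l).-1 - K + 2)) med.

Definition raw_protocol (f : mediatorT) (i : 'I_n) (l : seq (Obs C)) : Act C :=
  let o := cur_obs i l in
  let r := rnd K (size l).-1 in
  if r == K then
    inl (dec i o (if i == med then f (reports l) med else odflt z0 (received l)))
  else if r == 0%N then
    inr (z0, [ffun j => if (i != med) && (j == med) then Some (encO i o) else None])
  else if r == 1%N then
    inr (z0, [ffun j => if (i == med) && (j != med) then Some (f (reports l) j) else None])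
  else inr (silent G z0).

(** At the root [raw_protocol] would send a message; there [san] substitutes the forced root action.
    At later nonterminal histories [san] changes nothing. *)
Definition protocol (f : mediatorT) (i : 'I_n) : maxpure C :=
  fun X => let l := rcons (unzip1 X.1) X.2 in san medG z0 i l (raw_protocol f i l).

Lemma protocolE f i h' :
  protocol f i (infostate C i h') = san medG z0 i (olist i h') (raw_protocol f i (olist i h')).
Proof. by []. Qed.

Lemma protocol_legal f i : max_legal C i (protocol f i).
Proof. by move=> h' v nt _; rewrite protocolE; exact: san_legal. Qed.

Lemma not_game_at h' h r i : at_node h' h r -> h != [::] -> (r < K)%N ->
  ~~ is_game K (size (olist i h')).-1.
Proof.
by move=> an h0 rK; rewrite size_obslist /= (is_game_at an) not_game_node ?h0 // (an_r an).
Qed.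

Lemma protocol_report f i h' h : at_node h' h 0 -> h != [::] ->
  protocol f i (infostate C i h') =
  inr (z0, [ffun j => if (i != med) && (j == med) then Some (encO i (obs G i h)) else None]).
Proof.
move=> an h0; have K0 : (0 < K)%N by apply: ltn_trans K_gt1.
rewrite protocolE /raw_protocol (cur_obs_at _ an) size_obslist /= (rnd_at an) eq_sym gtn_eqF //=.
by rewrite san_comm_id ?(not_game_at _ an) //= ffunE; case: eqP.
Qed.

Lemma protocol_recommend f i h' h : at_node h' h 1 -> h != [::] ->
  protocol f i (infostate C i h') =
  inr (z0, [ffun j => if (i == med) && (j != med) then Some (f (reports (olist i h')) j)
                      else None]).
Proof.
move=> an h0.
rewrite protocolE /raw_protocol (cur_obs_at _ an) size_obslist /= (rnd_at an) ltn_eqF //=.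
by rewrite san_comm_id ?(not_game_at _ an) //= ffunE; case: eqP.
Qed.

Lemma protocol_silent f i h' h r : at_node h' h r -> h != [::] -> (1 < r < K)%N ->
  protocol f i (infostate C i h') = inr (silent G z0).
Proof.
move=> an h0 /andP[r1 rK].
rewrite protocolE /raw_protocol (cur_obs_at _ an) size_obslist /= (rnd_at an) ltn_eqF //=.
have [/negPf-> /negPf->] : r != 0%N /\ r != 1%N by split; lia.
by rewrite san_comm_id ?(not_game_at _ an) //= ffunE.
Qed.

Lemma protocol_act f i h' h : at_node h' h K -> h != [::] -> ~~ terminal G h ->
  protocol f i (infostate C i h') =
  inl (dec i (obs G i h)
    (if i == med then f (reports (olist i h')) med else odflt z0 (received (olist i h')))).
Proof.
move=> an h0 nt.
rewrite protocolE /raw_protocol (cur_obs_at _ an) size_obslist /= (rnd_at an) eqxx.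
apply: san_id; first exact: an_valid' an.
  by rewrite (at_node_terminal an).
rewrite /= /clegal (an_parse an) nt /game_node eqxx orbT /=.
have hs : (0 < size h)%N by rewrite lt0n size_eq0.
by have [+ _] := decP i (an_valid an) nt hs; apply.
Qed.

(** Matches the recommendation as read off the history in [follows_protocol] with the one that the
    player reads off its own observations. *)
Lemma received_at h' h i s m : at_node h' h K ->
  ohead (drop (size h' - K + 1) h') = Some s ->
  (if s.1 med is inr m then m.2 i else None) = Some m ->
  received (olist i h') = Some m.
Proof.
move=> an es em; rewrite /received /nth_obs size_obslist /=.
have le : (2 <= K)%N by [].
have hK : (K <= size h')%N.
  case: (eqVneq h [::]) => h0; first by have [-> ->] := an_nil an h0.
  by rewrite (an_size an h0) leqW // leq_addl.
(* [K - 2] rounds have passed since the recommendation became visible; the truncated subtractions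
   agree because [2 <= K <= size h']. *)
have e : (size h' - K + 2 = size h' - (K - 2))%N by lia.
rewrite e (nth_obslist_at _ _ an le) -e.
have an2 := at_node_take an le; rewrite -e addn2 in an2 *.
have szlt : (size h' - K + 1 < size h')%N.
  by rewrite ltnNge; apply/negP => le2; rewrite drop_oversize in es.
move: es; rewrite (drop_nth s szlt) /= => -[es].
rewrite addn1 in szlt es; rewrite (take_nth s szlt) es in an2 *.
by have /= -> := at_node_obsS i an2; rewrite /= ffunE.
Qed.

Lemma protocol_follows (f : mediatorT) i : z0 = 0%N :> nat ->
  follows_protocol G M K encO dec i (protocol f i).
Proof.
move=> z00 med' h' v' nt' _ h r p hs.
have an := at_node_parse v' p; rewrite (at_node_terminal an) in nt'.
have h0 : h != [::] by rewrite -size_eq0 -lt0n.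
split=> [r0|r1|rK|rK im s2 mm es em].
- subst r; eexists; split; first exact: protocol_report an h0.
  by [].
- subst r; eexists; split; first exact: protocol_recommend an h0.
  by split => // j; rewrite ffunE; case: (i == med); case: (j == med).
- by eexists; split; first exact: protocol_silent an h0 rK.
- subst r; rewrite /= (protocol_act _ _ an) // (negPf im).
  by rewrite (received_at an es em).
Qed.

(** * One step of play under the protocol *)

Section ProtocolRun.
Variables (f : mediatorT) (tau : advpure C).
Hypothesis tau_ok : adv_legal C tau.
Let sg := protocol f.
Let sg_ok : forall i, max_legal C i (sg i) := protocol_legal f.
Local Notation nxt := (joint_act (G := C) sg tau).
Local Notation run := (comm_run (M := M) (K := K) sg tau).

Variables (h0 : hist C) (h : hist G).
Hypothesis an : at_node h0 h 0.
Hypothesis hn : h != [::].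
Hypothesis nt : ~~ terminal G h.

Lemma size_run r : size (run r h0) = (size h0 + r)%N.
Proof. by elim: r => [|r IH]; rewrite ?addn0 //= size_rcons IH addnS. Qed.

Lemma nth_olist_rcons i h1 s p : (p <= size h1)%N ->
  nth_obs (olist i (rcons h1 s)) p = nth_obs (olist i h1) p.
Proof.
move=> le.
by rewrite /nth_obs obslist_rcons (nth_rcons _ (olist i h1)) size_obslist ltnS le.
Qed.

Lemma nth_olist_run i r p : (p <= size h0)%N ->
  nth_obs (olist i (run r h0)) p = nth_obs (olist i h0) p.
Proof.
move=> le; elim: r => [//|r IH] /=.
by rewrite nth_olist_rcons ?IH // size_run (leq_trans le) // leq_addr.
Qed.

Lemma nth_olist_last i h1 : nth_obs (olist i h1) (size h1) = obs C i h1.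
Proof.
have := nth_obslist i h1 [::] (inl (obs G med [::]) : Obs C).
by rewrite /nth_obs cats0.
Qed.

Lemma nth_olist_run_new i r r0 : (r0 <= r)%N ->
  nth_obs (olist i (run r h0)) (size h0 + r0) = obs C i (run r0 h0).
Proof.
elim: r => [|r IH]; last rewrite leq_eqVlt => /predU1P[->|].
- by rewrite leqn0 => /eqP ->; rewrite addn0 nth_olist_last.
- by rewrite -size_run nth_olist_last.
- by rewrite ltnS => le; rewrite nth_olist_rcons ?IH // size_run leq_add2l.
Qed.

(** Truthful for team MAX, including the mediator; for team MIN, whatever [tau] makes the player
    send to the mediator in round 0. *)
Definition actual_report : reportT :=
  [ffun i => if teamof G h i then Some (encO i (obs G i h))
             else if nxt h0 i is inr m then m.2 med else None].

Lemma med_max : teamof G h med. Proof. exact: teamof_mediator (an_valid an). Qed.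

Lemma nxt_max h1 r i : at_node h1 h r -> teamof G h i -> nxt h1 i = protocol f i (infostate C i h1).
Proof. by move=> a1 t; rewrite ffunE (an_team a1) t. Qed.

Lemma eq_reports_upto l1 l2 q :
  (forall p, (p <= (q.-1 * K.+1).+2)%N -> nth_obs l1 p = nth_obs l2 p) ->
  reports_upto l1 q = reports_upto l2 q.
Proof.
move=> H; rewrite /reports_upto; apply/eq_in_map => j; rewrite mem_iota add0n => /andP[_ jq].
have le : (j <= q.-1)%N by lia.
have le2 : (j * K.+1 <= q.-1 * K.+1)%N by rewrite leq_mul2r le orbT.
by rewrite !H //; lia.
Qed.

(** Earlier reports sit at positions that the run does not touch; only the last one is new. As this
    holds for every [r] from 1 to [K], the mediator recomputes the same list when it recommends and
    when it acts. *)
Lemma reports_run r : (0 < r <= K)%N ->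
  reports_upto (olist med (run r h0)) (size h) =
  rcons (reports_upto (olist med h0) (size h).-1) actual_report.
Proof.
move=> /andP[r0 rK]; have sz := an_size an hn; rewrite addn0 in sz.
have hs : (0 < size h)%N by rewrite lt0n size_eq0.
have e : iota 0 (size h) = rcons (iota 0 (size h).-1) (size h).-1.
  by case: (size h) hs => // m _; rewrite -cats1 -{1}addn1 iotaD.
rewrite /reports_upto e map_rcons; congr rcons.
  apply/eq_in_map => j; rewrite mem_iota add0n => /andP[_ jq].
  have le : ((j * K.+1).+2 <= size h0)%N.
    have : (j.+1 * K.+1 <= (size h).-1 * K.+1)%N by rewrite leq_mul2r jq orbT.
    by rewrite sz mulSn; lia.
  by rewrite !nth_olist_run // ltnW.
have -> : nth_obs (olist med (run r h0)) ((size h).-1 * K.+1).+1 = inl (obs G med h).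
  by rewrite -sz -[size h0]addn0 nth_olist_run_new //; exact: at_node_obs0.
have a1 := at_node_run sg_ok tau_ok an hn (leq_trans r0 rK) nt.
have -> : nth_obs (olist med (run r h0)) ((size h).-1 * K.+1).+2 =
    inr (msgview G med (nxt h0, None)).
  by rewrite -sz -addn1 nth_olist_run_new //; exact: at_node_obsS a1.
apply/ffunP => i; rewrite !ffunE.
case: eqP => [->|/eqP im]; first by rewrite med_max.
rewrite (an_team an); case: ifP => // t.
by rewrite /sg (protocol_report _ _ an hn) /= ffunE im eqxx.
Qed.

Lemma reports_olist_run r : (0 < r <= K)%N ->
  reports (olist med (run r h0)) =
  rcons (reports_upto (olist med h0) (size h).-1) actual_report.
Proof.
move=> rK; rewrite /reports -(reports_run rK) size_obslist /= size_run (an_size an hn) addn0 /=.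
rewrite divnMDl // divn_small ?addn0 ?prednK ?lt0n ?size_eq0 //.
by case/andP: rK.
Qed.

Definition recommendation : {ffun 'I_n -> 'I_M} :=
  f (rcons (reports_upto (olist med h0) (size h).-1) actual_report).

Lemma an_run r : (r <= K)%N -> at_node (run r h0) h r.
Proof. by move=> rK; exact: at_node_run. Qed.

Lemma nxt_report i : teamof G h i -> nxt h0 i =
  inr (z0, [ffun j => if (i != med) && (j == med) then Some (encO i (obs G i h)) else None]).
Proof. by move=> t; rewrite (nxt_max an t) (protocol_report _ _ an). Qed.

Lemma nxt_recommend i : teamof G h i -> nxt (run 1 h0) i =
  inr (z0, [ffun j => if (i == med) && (j != med) then Some (recommendation j) else None]).
Proof.
move=> t; have a1 := an_run (ltnW K_gt1).
rewrite (nxt_max a1 t) (protocol_recommend _ _ a1) //.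
congr (inr (_, _)); apply/ffunP => j; rewrite !ffunE.
have K1 : (0 < 1 <= K)%N := ltnW K_gt1.
by case: eqP => [->|//]; rewrite (reports_olist_run K1).
Qed.

Lemma nxt_silent i r : (1 < r < K)%N -> teamof G h i -> nxt (run r h0) i = inr (silent G z0).
Proof.
move=> rK t; have le : (r <= K)%N by case/andP: rK => _ /ltnW.
by rewrite (nxt_max (an_run le) t) (protocol_silent _ _ (an_run le)).
Qed.

Lemma nxt_act i : teamof G h i -> nxt (run K h0) i = inl (dec i (obs G i h) (recommendation i)).
Proof.
move=> t; rewrite (nxt_max (an_run (leqnn K)) t) (protocol_act _ _ (an_run (leqnn K))) //.
case: eqP => [->|/eqP im]; first by rewrite reports_olist_run // leqnn (ltn_trans _ K_gt1).
have -> : received (olist i (run K h0)) = Some (recommendation i); last by [].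
rewrite /received size_obslist /= size_run addnK nth_olist_run_new //.
rewrite (at_node_obsS _ (an_run (K_gt1 : (2 <= K)%N))) /= ffunE nxt_recommend ?med_max //=.
by rewrite ffunE eqxx im.
Qed.

Lemma reports_next s :
  reports_upto (olist med (rcons (run K h0) s)) (size h) =
  rcons (reports_upto (olist med h0) (size h).-1) actual_report.
Proof.
rewrite -(@reports_run K) ?leqnn ?(ltn_trans _ K_gt1) //; apply: eq_reports_upto => p le.
by rewrite nth_olist_rcons // size_run (an_size an hn); lia.
Qed.

End ProtocolRun.
End Protocol.

(** * Simulation of an extension by the protocol *)

Section Root.
Variables (R : realType) (G : hrg R) (M K : nat).
Hypothesis medG : mediated_hrg G.
Local Notation C := (Comm G M K).

Definition root_joint : {ffun 'I_(np G) -> Act G} := [ffun i => root_act medG i].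

Definition root_hist (c : CAct G) : hist C := [:: ([ffun i => inl (root_joint i)], Some c)].

Lemma at_node_root c : (0 < chance G [::] c)%R ->
  at_node (K := K) (root_hist c) [:: (root_joint, c)] 0.
Proof.
move=> c0; apply: (at_node_game (at_node_nil G M K) _ (hrg_root medG) erefl _ c0) => //.
by move=> i; rewrite ffunE root_actP.
Qed.

(** Each player has a single legal root action, so all legal strategies reach the same histories
    [root_hist c]. *)
Lemma play_root sg tau d : (forall i, max_legal C i (sg i)) -> adv_legal C tau ->
  (play C sg tau d.+1 [::] = \sum_c chance G [::] c * play C sg tau d (root_hist c))%R.
Proof.
move=> sg_ok tau_ok.
have gn : game_node K ([::] : hist G) 0 by [].
rewrite (play_game _ _ _ (at_node_nil G M K) gn (hrg_root medG)).
have [a ea la] := joint_act_game sg_ok tau_ok (at_node_nil G M K) gn (hrg_root medG).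
have -> : joint_act (G := C) sg tau [::] = [ffun i => inl (root_joint i)]; last by [].
rewrite ea; apply/ffunP => i; rewrite !ffunE; congr inl.
exact: hrg_root_uniq (la i) (root_actP medG i).
Qed.

End Root.

(** * Self-play of a profile on reported observations *)

Section Simulation.
Variables (R : realType) (G : hrg R) (M K M' K' : nat).
Hypothesis medG : mediated_hrg G.
Hypothesis K_gt1 : (1 < K)%N.
Variables (z0 : 'I_M) (z0' : 'I_M').
Variables (encO : 'I_(np G) -> Obs G -> 'I_M)
  (dec : 'I_(np G) -> Obs G -> 'I_M -> Act G).
Hypothesis encP : obs_encoding G encO.
Hypothesis decP : act_decoding G dec.
Local Notation C := (Comm G M K).
Local Notation C' := (Comm G M' K').
Local Notation n := (np G).
Local Notation med := (mediator G).
Local Notation atC := (@at_node R G M K).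
Local Notation atC' := (@at_node R G M' K').
Local Notation olist i h := (obslist (G := C) i h).
Local Notation olist' i h := (obslist (G := C') i h).

(** Inverts [encO] on reachable observations. A MIN player may send nothing or a code of no such
    observation; the root observation then serves as default claim. *)
Definition claim (i : 'I_n) (ro : option 'I_M) : Obs G :=
  if ro is Some m then
    if pselect (exists h : hist G, [/\ valid G h, ~~ terminal G h, h != [::]
                                     & encO i (obs G i h) = m]) is left H
    then obs G i (projT1 (cid H)) else obs G i [::]
  else obs G i [::].

Lemma claimK i h : valid G h -> ~~ terminal G h -> h != [::] ->
  claim i (Some (encO i (obs G i h))) = obs G i h.
Proof.
move=> v nt h0; rewrite /claim; case: pselect => [H|]; last by case; exists h.
case: (cid H) => h1 [v1 nt1 h10 e] /=.
by apply: (encP (i := i)) => //; rewrite lt0n size_eq0.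
Qed.

Definition enc_act (i : 'I_n) (o : Obs G) (a : Act G) : 'I_M :=
  odflt z0 [pick m | dec i o m == a].

Lemma enc_actK i h a : valid G h -> ~~ terminal G h -> h != [::] -> legal G h i a ->
  dec i (obs G i h) (enc_act i (obs G i h) a) = a.
Proof.
move=> v nt h0 la; rewrite /enc_act; case: pickP => [m /eqP //|no].
have hs : (0 < size h)%N by rewrite lt0n size_eq0.
have [_ /(_ _ la)[m em]] := decP i v nt hs.
by have := no m; rewrite em eqxx.
Qed.

Definition act_of (i : 'I_n) (A : finType) (b : Act G + A) : Act G :=
  if b is inl a then a else root_act medG i.

(** False claims can lead the simulation to information states that never occur in play, where [s]
    may act illegally; [san] repairs this. *)
Definition safe (s : 'I_n -> maxpure C') (i : 'I_n) (X : infoT C') : Act C' :=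
  san medG z0' i (rcons (unzip1 X.1) X.2) (s i X).

(* Self-play of the profile s on claimed observations, as carried out privately
   by the mediator: X i is the simulated information state of player i. *)
Definition sim_step (s : 'I_n -> maxpure C') (X : 'I_n -> infoT C') : 'I_n -> infoT C' :=
  fun i => (rcons (X i).1 ((X i).2, safe s i (X i)),
            inr (msgview G i ([ffun j => safe s j (X j)], None))).

Definition pastT := 'I_n -> seq (Obs C' * Act C').

Definition sim_run (s : 'I_n -> maxpure C') (P : pastT) (w : 'I_n -> Obs G) (r : nat)
  : 'I_n -> infoT C' := iter r (sim_step s) (fun i => (P i, inl (w i))).

Definition sim_rec (s : 'I_n -> maxpure C') (P : pastT) (w : 'I_n -> Obs G)
  : {ffun 'I_n -> 'I_M} :=
  [ffun i => enc_act i (w i) (act_of i (safe s i (sim_run s P w K' i)))].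

Definition claims (rho : reportT G M) : 'I_n -> Obs G := fun i => claim i (rho i).

Definition start_past : pastT := fun i => [:: (inl (obs G i [::]), inl (root_act medG i))].

(** The last of the [K'.+1] simulated moves is the game move. Only the first component is kept,
    since the next observation comes from the next report and not from a message view. *)
Definition sim_past (s : 'I_n -> maxpure C') (rhos : seq (reportT G M)) : pastT :=
  foldl (fun P rho i => (sim_run s P (claims rho) K'.+1 i).1) start_past rhos.

Definition sim_mediator (s : 'I_n -> maxpure C') : mediatorT G M := fun rhos =>
  if rev rhos is rho :: t then sim_rec s (sim_past s (rev t)) (claims rho)
  else [ffun _ => z0].

Lemma sim_mediator_rcons s rhos rho :
  sim_mediator s (rcons rhos rho) = sim_rec s (sim_past s rhos) (claims rho).
Proof. by rewrite /sim_mediator rev_rcons revK. Qed.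

Lemma sim_past_rcons s rhos rho :
  sim_past s (rcons rhos rho) = fun i => (sim_run s (sim_past s rhos) (claims rho) K'.+1 i).1.
Proof. by rewrite /sim_past foldl_rcons. Qed.

Lemma size_sim_run s P w r i : size (sim_run s P w r i).1 = (size (P i) + r)%N.
Proof. by elim: r => [|r IH]; rewrite ?addn0 //= size_rcons IH addnS. Qed.

Lemma size_sim_past s rhos i : size (sim_past s rhos i) = (size rhos * K'.+1).+1.
Proof.
elim/last_ind: rhos => [//|rhos rho IH].
by rewrite sim_past_rcons size_sim_run IH size_rcons mulSn; lia.
Qed.

(** * Reconstructing the view of [tau] during one step *)

Section Adversary.
Variable tau : advpure C.

(* Stand-ins for the MAX players' messages, indistinguishable from the real ones to
   team MIN: the contents of reports (here z0) and the recommendations to MAX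
   players (arbitrary entries of rec) are not visible to MIN players. *)
Definition ghost (rec : {ffun 'I_n -> 'I_M}) (r : nat) (j : 'I_n) : Act C :=
  if r == 0%N then
    inr (z0, [ffun l => if (j != med) && (l == med) then Some z0 else None])
  else if r == 1%N then
    inr (z0, [ffun l => if (j == med) && (l != med) then Some (rec l) else None])
  else inr (silent G z0).

(** Agreement of two actions of one sender in each of the three components of [msgview] for player
    [i]. *)
Definition same_view (i : 'I_n) (b c : Act C) : Prop :=
  [/\ (if b is inr m then Some m.1 else None) = (if c is inr m then Some m.1 else None),
      (if b is inr m then m.2 i else None) = (if c is inr m then m.2 i else None) &
      forall l, (if b is inr m then m.2 l != None else false)
              = (if c is inr m then m.2 l != None else false)].

Lemma msgview_eq i (a b : {ffun 'I_n -> Act G + MsgT n M}) :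
  (forall j, same_view i (a j) (b j)) -> msgview G i (a, None) = msgview G i (b, None).
Proof.
move=> H; congr (_, _, _); apply/ffunP.
- by move=> j; rewrite !ffunE; case: (H j).
- by move=> j; rewrite !ffunE; case: (H j).
- by move=> [j l]; rewrite !ffunE; case: (H j).
Qed.

Definition adv_step (g : 'I_n -> Act C) (I : advinfoT C) : advinfoT C :=
  let m : {ffun 'I_n -> Act G + MsgT n M} :=
    [ffun j => if I.2 j is Some _ then tau I j else g j] in
  (rcons I.1 [ffun i => omap (fun o => (o, tau I i)) (I.2 i)],
   [ffun i => omap (fun _ => inr (msgview G i (m, None))) (I.2 i)]).

Definition adv_pastT := seq {ffun 'I_n -> option (Obs C * Act C)}.

Fixpoint adv_run (L : adv_pastT) (o : {ffun 'I_n -> option (Obs G)})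
    (rec : {ffun 'I_n -> 'I_M}) (r : nat) : advinfoT C :=
  if r is r'.+1 then adv_step (ghost rec r') (adv_run L o rec r')
  else (L, [ffun i => omap inl (o i)]).

(** Uses only what [tau] knows before any recommendation. Hence the simulation that produces the
    recommendations can start from these claims without circularity. *)
Definition adv_claim (L : adv_pastT) (o : {ffun 'I_n -> option (Obs G)}) : 'I_n -> Obs G :=
  fun i => claim i (if tau (L, [ffun i => omap inl (o i)]) i is inr m then m.2 med else None).

Definition adv_past (L : adv_pastT) o rec : adv_pastT :=
  let I := adv_run L o rec K in
  rcons I.1 [ffun i => omap (fun x => (x, tau I i)) (I.2 i)].

Definition min_obs (h : hist G) : {ffun 'I_n -> option (Obs G)} :=
  [ffun i => if teamof G h i then None else Some (obs G i h)].

Section ProtocolSide.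
Hypothesis tau_ok : adv_legal C tau.
Variable f : mediatorT G M.
Local Notation sg := (protocol (K := K) medG z0 encO dec f).
Local Notation nxt := (joint_act (G := C) sg tau).
Local Notation run := (comm_run (M := M) (K := K) sg tau).
Variables (h0 : hist C) (h : hist G) (rec : {ffun 'I_n -> 'I_M}).
Hypothesis an : atC h0 h 0.
Hypothesis hn : h != [::].
Hypothesis nt : ~~ terminal G h.
Hypothesis recP : forall i, ~~ teamof G h i ->
  rec i = recommendation (K := K) medG z0 encO dec f tau h0 h i.

Lemma advinfo_obs h1 r : atC h1 h r ->
  (advinfo C h1).2 = [ffun i => if teamof G h i then None else Some (obs C i h1)].
Proof. by move=> a1; apply/ffunP => i; rewrite !ffunE (an_team a1). Qed.

Lemma min_neq_med i : ~~ teamof G h i -> i != med.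
Proof. by apply: contraNneq => ->; exact: teamof_mediator (an_valid an). Qed.

Lemma ghost_view i r j : (r < K)%N -> ~~ teamof G h i -> teamof G h j ->
  same_view i (nxt (run r h0) j) (ghost rec r j).
Proof.
move=> rK ti tj; have im := min_neq_med ti; rewrite /ghost /same_view.
case: r rK => [|[|r]] rK.
- rewrite (nxt_report _ _ _ _ _ _ _ an) //=; split => //.
    by rewrite !ffunE (negPf im) andbF.
  by move=> l; rewrite !ffunE; case: ifP.
- rewrite (nxt_recommend _ _ _ _ _ _ tau_ok an) //=; split => //.
    by rewrite !ffunE im recP.
  by move=> l; rewrite !ffunE; case: ifP.
- by rewrite (nxt_silent _ _ _ _ _ _ tau_ok an).
Qed.

(** To team MIN the messages of team MAX are predictable except for the recommendations to MIN
    players, which [rec] supplies. So the information of [tau] is a function of its past, the MIN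
    observations and [rec]. *)
Lemma adv_run_advinfo r : (r <= K)%N ->
  advinfo C (run r h0) = adv_run (advinfo C h0).1 (min_obs h) rec r.
Proof.
elim: r => [_|r IH rK].
  rewrite /= [advinfo C h0]surjective_pairing (advinfo_obs an); congr (_, _).
  apply/ffunP => i; rewrite !ffunE; case: ifP => //= _.
  by rewrite -(at_node_obs0 i an).
have ar := an_run medG z0 encO dec f tau_ok an hn nt (ltnW rK).
have ar1 : atC (rcons (run r h0) (nxt (run r h0), None)) h r.+1.
  exact: (an_run medG z0 encO dec f tau_ok an hn nt rK).
rewrite [RHS]/= -IH ?(ltnW rK) // /adv_step.
rewrite -[run r.+1 h0]/(rcons (run r h0) (nxt (run r h0), None)).
rewrite [LHS]surjective_pairing (advinfo_obs ar1).
rewrite advinfo_rcons (advinfo_obs ar); congr (rcons _ _, _).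
  by apply/ffunP => i; rewrite !ffunE (an_team ar); case: ifP.
apply/ffunP => i; rewrite [LHS]ffunE [RHS]ffunE ffunE (at_node_obsS i ar1).
case: ifP => // /negbT ti; congr (Some (inr _)).
apply: msgview_eq => j; rewrite [X in same_view _ _ X]ffunE [in X in same_view _ _ X]ffunE.
case: (boolP (teamof G h j)) => tj; first exact: ghost_view.
by rewrite ffunE (an_team ar) (negPf tj).
Qed.

Lemma adv_past_advinfo s : s.1 = nxt (run K h0) ->
  (advinfo C (rcons (run K h0) s)).1 = adv_past (advinfo C h0).1 (min_obs h) rec.
Proof.
move=> es; have aK := an_run medG z0 encO dec f tau_ok an hn nt (leqnn K).
rewrite advinfo_rcons /= /adv_past -adv_run_advinfo // (advinfo_obs aK); congr rcons.
by apply/ffunP => i; rewrite es !ffunE (an_team aK); case: ifP.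
Qed.

Lemma nxt_min h1 r i : atC h1 h r -> ~~ teamof G h i -> nxt h1 i = tau (advinfo C h1) i.
Proof. by move=> a1 t; rewrite ffunE (an_team a1) (negPf t). Qed.

Lemma adv_claimE i : ~~ teamof G h i ->
  adv_claim (advinfo C h0).1 (min_obs h) i =
  claims (actual_report (K := K) medG z0 encO dec f tau h0 h) i.
Proof.
move=> t; rewrite /adv_claim /claims [in RHS]ffunE (negPf t) (nxt_min an t).
by have /= -> := adv_run_advinfo (leq0n K).
Qed.

End ProtocolSide.

(** * The adversary of [C'] that mimics [tau] *)

Section Automaton.
Variable sA : 'I_n -> maxpure C'.

(* Memory of the adversary of C' that mimics tau: the round within the current
   step of G, the simulated pasts of the MIN players (who act as sA would on the
   observations that tau makes them claim), the past of tau in C, and the true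
   observations of the MIN players at the current step. *)
Record adv_state := AdvState {
  as_r : nat;
  as_past : pastT;
  as_L : adv_pastT;
  as_o : {ffun 'I_n -> option (Obs G)} }.

Definition adv_obsT := {ffun 'I_n -> option (Obs C')}.

Definition cur_min_obs (st : adv_state) (O : adv_obsT) : {ffun 'I_n -> option (Obs G)} :=
  if as_r st == 0%N then [ffun i => if O i is Some (inl x) then Some x else None] else as_o st.

(** In round 0 the true observation is replaced by the claim that [tau] makes; in later rounds the
    real message views of [C'] are used. *)
Definition cur_info (st : adv_state) (O : adv_obsT) (i : 'I_n) : infoT C' :=
  (as_past st i,
   if as_r st == 0%N then inl (adv_claim (as_L st) (cur_min_obs st O) i)
   else if O i is Some x then x else inl (obs G i [::])).

(** Intended for round [K'], where the simulated strategy chooses a game action, and for MIN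
    players. *)
Definition cur_rec (st : adv_state) (O : adv_obsT) : {ffun 'I_n -> 'I_M} :=
  [ffun i => enc_act i (adv_claim (as_L st) (cur_min_obs st O) i)
                       (act_of i (safe sA i (cur_info st O i)))].

Definition adv_feed (st : adv_state) (O : adv_obsT) : adv_state :=
  let past i := rcons (cur_info st O i).1 ((cur_info st O i).2, safe sA i (cur_info st O i)) in
  if as_r st == K' then
    AdvState 0 past (adv_past (as_L st) (cur_min_obs st O) (cur_rec st O)) (cur_min_obs st O)
  else AdvState (as_r st).+1 past (as_L st) (cur_min_obs st O).

(** Once the recommendations are known, after [K'] rounds, a whole step of [C] is replayed for
    [tau], and its game action is played. *)
Definition adv_out (st : adv_state) (O : adv_obsT) (i : 'I_n) : Act C' :=
  if as_r st == K'
  then inl (act_of i (tau (adv_run (as_L st) (cur_min_obs st O) (cur_rec st O) K) i))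
  else safe sA i (cur_info st O i).

Definition adv_start : adv_state :=
  AdvState 0 start_past [:: [ffun _ => None]] [ffun _ => None].

Definition past_obs (I : advinfoT C') : seq adv_obsT :=
  [seq [ffun i => omap fst (e i)] | e : {ffun 'I_n -> option (Obs C' * Act C')} <- I.1].

(** [behead] drops the root entry: everyone counts as MAX there, and [adv_start] already accounts
    for the root step. *)
Definition adv_state_of (I : advinfoT C') : adv_state :=
  foldl adv_feed adv_start (behead (past_obs I)).

Definition own_obs (I : advinfoT C') (i : 'I_n) : seq (Obs C') :=
  rcons [seq if e i is Some x then x.1 else inl (obs G i [::])
        | e : {ffun 'I_n -> option (Obs C' * Act C')} <- I.1]
        (if I.2 i is Some x then x else inl (obs G i [::])).

Definition sim_adv : advpure C' := fun I =>
  [ffun i => san medG z0' i (own_obs I i) (adv_out (adv_state_of I) (I.2) i)].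

Lemma own_obsE h' i : ~~ teamof C' h' i -> own_obs (advinfo C' h') i = olist' i h'.
Proof.
move=> t; rewrite /own_obs /obslist; congr rcons; last by rewrite ffunE (negPf t).
(* The induction must pass through the root, where [i] counts as MAX; the default root observation
   in [own_obs] is correct there. *)
have {t}: h' = [::] \/ ~~ teamof C' h' i by right.
elim/last_ind: h' => [//|h' s IH] [e|t]; first by case: (h') e.
rewrite advinfo_rcons infostate_rcons /unzip1 !map_rcons.
have H : h' = [::] \/ ~~ teamof C' h' i.
  by case: (h') t => [|x l]; [left|right].
have := IH H; rewrite /unzip1 => ->; congr rcons; rewrite !ffunE.
case: H => [->//|/negPf ->//].
Qed.

Lemma sim_adv_legal : adv_legal C' sim_adv.
Proof. by move=> h' v nt i t; rewrite ffunE own_obsE //; exact: san_legal. Qed.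

Lemma adv_state_of_rcons h' s : h' != [::] ->
  adv_state_of (advinfo C' (rcons h' s)) =
  adv_feed (adv_state_of (advinfo C' h')) (advinfo C' h').2.
Proof.
move=> h0; rewrite /adv_state_of advinfo_rcons /past_obs map_rcons /=.
rewrite -foldl_rcons; congr (foldl _ _ _).
have -> : [ffun i => omap fst ([ffun i => omap (fun o => (o, s.1 i))
             ((advinfo C' h').2 i)] i)] = (advinfo C' h').2.
  by apply/ffunP => i; rewrite !ffunE; case: (teamof _ _ _).
by case: h' h0 => //= x l _.
Qed.

(** * Coupling a play of the protocol with a play of [C'] *)

Section Relation.
Variables (sM sC : 'I_n -> maxpure C') (T : 'I_n -> bool).
Hypothesis sM_ok : forall i, max_legal C' i (sM i).
Hypothesis tau_ok : adv_legal C tau.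
Hypothesis sCM : forall i, T i -> sC i = sM i.
Hypothesis sCA : forall i, ~~ T i -> sC i = sA i.
Variable f : mediatorT G M.
Hypothesis fP : forall rhos, (size rhos <= depth G)%N -> f rhos = sim_mediator sC rhos.
Local Notation sg := (protocol (K := K) medG z0 encO dec f).
Local Notation nxt := (joint_act (G := C) sg tau).
Local Notation run := (comm_run (M := M) (K := K) sg tau).
Local Notation nxt' := (joint_act (G := C') sM sim_adv).
Local Notation run' := (comm_run (M := M') (K := K') sM sim_adv).
Local Notation past_reports hC h := (reports_upto (K := K) encO (olist med hC) (size h).-1).
Local Notation astate h' := (adv_state_of (advinfo C' h')).

(** [sM] is played by team MAX in [C'], [sA] is the adversary's own sample, and [sC] combines them
    in the mediator's head. At the start of a step both plays are at [h], and the mediator's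
    simulated pasts are the real ones for team MAX and the automaton's for team MIN. *)
Record rel (hC : hist C) (h' : hist C') (h : hist G) : Prop := Rel {
  rel_at : atC hC h 0;
  rel_at' : atC' h' h 0;
  rel_nonnil : h != [::];
  rel_team : teamof G h = T;
  rel_max : forall i, T i -> (infostate C' i h').1 = sim_past sC (past_reports hC h) i;
  rel_r : as_r (astate h') = 0%N;
  rel_L : as_L (astate h') = (advinfo C hC).1;
  rel_min : forall i, ~~ T i -> as_past (astate h') i = sim_past sC (past_reports hC h) i }.

Section Step.
Variables (hC : hist C) (h' : hist C') (h : hist G).
Hypothesis hrel : rel hC h' h.
Hypothesis nt : ~~ terminal G h.

Let rho := actual_report (K := K) medG z0 encO dec f tau hC h.
Let P := sim_past sC (past_reports hC h).
Local Notation X := (sim_run sC P (claims rho)).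

Lemma team_T h1 r : atC' h1 h r -> teamof C' h1 = T.
Proof. by move=> a1; rewrite (an_team a1) (rel_team hrel). Qed.

Definition in_sync (h1 : hist C') (r : nat) : Prop :=
  [/\ forall i, T i -> infostate C' i h1 = X r i,
      as_r (astate h1) = r,
      as_L (astate h1) = (advinfo C hC).1,
      cur_min_obs (astate h1) (advinfo C' h1).2 = min_obs h &
      forall i, ~~ T i -> cur_info (astate h1) (advinfo C' h1).2 i = X r i].

Lemma claims_max i : T i -> claims rho i = obs G i h.
Proof.
move=> t; rewrite /claims ffunE (rel_team hrel) t claimK //; last exact: rel_nonnil hrel.
exact: an_valid (rel_at hrel).
Qed.

Lemma claims_min i : ~~ T i -> adv_claim (advinfo C hC).1 (min_obs h) i = claims rho i.
Proof.
move=> t; pose rec := recommendation (K := K) medG z0 encO dec f tau hC h.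
apply: (adv_claimE tau_ok (rec := rec)) => //.
- exact: rel_at hrel.
- exact: rel_nonnil hrel.
- by rewrite (rel_team hrel).
Qed.

Lemma in_sync0 : in_sync h' 0.
Proof.
have a' := rel_at' hrel.
have eO : cur_min_obs (astate h') (advinfo C' h').2 = min_obs h.
  apply/ffunP => i; rewrite /cur_min_obs (rel_r hrel) eqxx !ffunE (an_team a').
  by case: ifP => // _; rewrite (at_node_obs0 i a').
split => //; [|exact: (rel_r hrel)|exact: (rel_L hrel)|].
- move=> i t; rewrite [LHS]surjective_pairing (rel_max hrel t) [X in (_, X)](at_node_obs0 i a').
  by rewrite /sim_run /= claims_max.
- move=> i t; rewrite /cur_info eO (rel_r hrel) eqxx (rel_L hrel) (rel_min hrel t).
  by rewrite claims_min.
Qed.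

Lemma in_sync_max h1 r i : atC' h1 h r -> in_sync h1 r -> T i -> nxt' h1 i = safe sC i (X r i).
Proof.
move=> a1 [iM _ _ _ _] t; rewrite ffunE (team_T a1) t -iM // /safe sCM //.
rewrite san_id //; first exact: an_valid' a1.
  by rewrite (at_node_terminal a1).
by apply: sM_ok; rewrite ?(team_T a1) //; [exact: an_valid' a1 | rewrite (at_node_terminal a1)].
Qed.

Lemma game_X h1 r i : atC' h1 h r ->
  is_game K' (size (rcons (unzip1 (X r i).1) (X r i).2)).-1 = (r == K').
Proof.
move=> a1; rewrite size_rcons size_map /= size_sim_run size_sim_past.
have -> : (size (past_reports hC h) * K'.+1).+1 + r = size h1.
  by rewrite size_map size_iota (an_size a1 (rel_nonnil hrel)) addSn.
by rewrite (is_game_at a1) /game_node size_eq0 (negPf (rel_nonnil hrel)).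
Qed.

Lemma in_sync_comm h1 r : atC' h1 h r -> (r < K')%N -> in_sync h1 r ->
  nxt' h1 = [ffun i => safe sC i (X r i)].
Proof.
move=> a1 rK sy; apply/ffunP => i; rewrite [RHS]ffunE.
case: (boolP (T i)) => t; first exact: in_sync_max.
have [_ er _ _ iA] := sy.
rewrite ffunE (team_T a1) (negPf t) ffunE /adv_out er ltn_eqF // iA //.
have -> : safe sC i (X r i) = safe sA i (X r i) by rewrite /safe sCA.
(* [sim_adv] sanitizes against true observations, [safe] against claimed ones; in a communication
   round both only check the shape of the message. *)
rewrite own_obsE ?(team_T a1) // /safe.
have [|m -> lm] := san_comm medG z0' i (l := rcons (unzip1 (X r i).1) (X r i).2) (sA i (X r i)).
  by rewrite (game_X _ a1) ltn_eqF.
apply: san_comm_id => //; rewrite size_obslist /= (is_game_at a1).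
by rewrite not_game_node ?(an_r a1) // (rel_nonnil hrel).
Qed.

Lemma nonnil' h1 r : atC' h1 h r -> h1 != [::].
Proof. by move=> a1; rewrite (at_node_nonnil a1) (rel_nonnil hrel). Qed.

Lemma in_sync_step h1 r : atC' h1 h r -> (r < K')%N -> in_sync h1 r ->
  atC' (rcons h1 (nxt' h1, None)) h r.+1 -> in_sync (rcons h1 (nxt' h1, None)) r.+1.
Proof.
move=> a1 rK sy a2; have e := in_sync_comm a1 rK sy; have [iM er eL eo iA] := sy.
have est : astate (rcons h1 (nxt' h1, None)) = adv_feed (astate h1) (advinfo C' h1).2.
  by rewrite adv_state_of_rcons // (nonnil' a1).
have [fr fL fo fp] : [/\ as_r (adv_feed (astate h1) (advinfo C' h1).2) = r.+1,
    as_L (adv_feed (astate h1) (advinfo C' h1).2) = (advinfo C hC).1,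
    as_o (adv_feed (astate h1) (advinfo C' h1).2) = min_obs h &
    forall i, ~~ T i -> as_past (adv_feed (astate h1) (advinfo C' h1).2) i =
      rcons (X r i).1 ((X r i).2, safe sA i (X r i))].
  by rewrite /adv_feed er ltn_eqF //; split => // i t; rewrite -iA.
rewrite /in_sync est; split => //.
- move=> i t; rewrite infostate_rcons (at_node_obsS i a2) iM //= e /sim_step ffunE.
  by rewrite /sim_run.
- by rewrite /cur_min_obs fr.
- move=> i t; have eO : (advinfo C' (rcons h1 (nxt' h1, None))).2 i =
      Some (inr (msgview G i (nxt' h1, None))).
    by rewrite [LHS]ffunE (team_T a2) (negPf t) (at_node_obsS i a2).
  by rewrite /cur_info fr fp // eO /= e /sim_step /safe sCA.
Qed.

Lemma in_sync_run r : (r <= K')%N -> in_sync (run' r h') r.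
Proof.
elim: r => [_|r IH rK]; first exact: in_sync0.
have a1 := at_node_run sM_ok sim_adv_legal (rel_at' hrel) (rel_nonnil hrel) (ltnW rK) nt.
have a2 := at_node_run sM_ok sim_adv_legal (rel_at' hrel) (rel_nonnil hrel) rK nt.
exact: (in_sync_step a1 rK (IH (ltnW rK)) a2).
Qed.

Local Notation recm := (recommendation (K := K) medG z0 encO dec f tau hC h).

Lemma recommendationE : recm = sim_rec sC P (claims rho).
Proof.
rewrite /recommendation fP ?sim_mediator_rcons // size_rcons size_map size_iota.
rewrite prednK ?lt0n ?size_eq0 ?(rel_nonnil hrel) //.
exact: valid_size (an_valid (rel_at hrel)).
Qed.

Lemma cur_recE h1 : in_sync h1 K' ->
  forall i, ~~ teamof G h i -> cur_rec (astate h1) (advinfo C' h1).2 i = recm i.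
Proof.
move=> [_ _ eL eo iA] i; rewrite (rel_team hrel) => t.
rewrite recommendationE [LHS]ffunE [RHS]ffunE eL eo claims_min // iA //.
by rewrite /safe sCA.
Qed.

(** A MAX player reports truthfully, so encoding and decoding its simulated action returns that
    action. A MIN player plays in [C'] exactly what [tau] plays in [C], whatever was recommended. *)
Lemma in_sync_game h1 (a : {ffun 'I_n -> Act G}) : atC' h1 h K' -> in_sync h1 K' ->
  nxt (run K hC) = [ffun i => inl (a i)] -> (forall i, legal G h i (a i)) ->
  nxt' h1 = [ffun i => inl (a i)].
Proof.
move=> a1 sy ea la; have [iM er eL eo iA] := sy.
have v := an_valid (rel_at hrel); have hn := rel_nonnil hrel.
have gn : game_node K' h K' by rewrite /game_node eqxx orbT.
apply/ffunP => i; rewrite [RHS]ffunE.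
case: (boolP (T i)) => t.
  have [b eb lb] := joint_act_game sM_ok sim_adv_legal a1 gn nt.
  have es : safe sC i (X K' i) = inl (b i) by rewrite -(in_sync_max a1 sy t) eb ffunE.
  rewrite eb ffunE; congr inl.
  have : nxt (run K hC) i = inl (a i) by rewrite ea ffunE.
  rewrite (nxt_act _ _ _ _ decP _ tau_ok (rel_at hrel)) ?(rel_team hrel) // => -[<-].
  by rewrite recommendationE [sim_rec _ _ _ _]ffunE es /= claims_max // enc_actK.
have et : tau (advinfo C (run K hC)) i = inl (a i).
  have aK := an_run medG z0 encO dec f tau_ok (rel_at hrel) hn nt (leqnn K).
  transitivity (nxt (run K hC) i); last by rewrite ea ffunE.
  by rewrite [RHS]ffunE (an_team aK) (rel_team hrel) (negPf t).
rewrite ffunE (team_T a1) (negPf t) ffunE /adv_out er eqxx eL eo.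
rewrite -(adv_run_advinfo tau_ok (rel_at hrel) hn nt (cur_recE sy) (leqnn K)) et /=.
rewrite own_obsE ?(team_T a1) // san_id //; first exact: an_valid' a1.
  by rewrite (at_node_terminal a1).
by rewrite /= /clegal (an_parse a1) nt gn la.
Qed.

Lemma rel_next (a : {ffun 'I_n -> Act G}) c :
  nxt (run K hC) = [ffun i => inl (a i)] -> (forall i, legal G h i (a i)) ->
  (0 < chance G h c)%R ->
  rel (rcons (run K hC) (nxt (run K hC), Some c))
      (rcons (run' K' h') (nxt' (run' K' h'), Some c)) (rcons h (a, c)).
Proof.
move=> ea la c0; have hn := rel_nonnil hrel.
have aK := an_run medG z0 encO dec f tau_ok (rel_at hrel) hn nt (leqnn K).
have a1 := at_node_run sM_ok sim_adv_legal (rel_at' hrel) hn (leqnn K') nt.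
have sy := in_sync_run (leqnn K'); have [iM er eL eo iA] := sy.
have ea' := in_sync_game a1 sy ea la.
have gn L : game_node L h L by rewrite /game_node eqxx orbT.
have ereps : past_reports (rcons (run K hC) (nxt (run K hC), Some c)) (rcons h (a, c)) =
    rcons (past_reports hC h) rho.
  by rewrite size_rcons /=; exact: (reports_next _ _ _ _ _ _ tau_ok (rel_at hrel) hn nt).
have est : astate (rcons (run' K' h') (nxt' (run' K' h'), Some c)) =
    adv_feed (astate (run' K' h')) (advinfo C' (run' K' h')).2.
  by rewrite adv_state_of_rcons // (nonnil' a1).
have [fr fL fp] : [/\ as_r (adv_feed (astate (run' K' h')) (advinfo C' (run' K' h')).2) = 0%N,
    as_L (adv_feed (astate (run' K' h')) (advinfo C' (run' K' h')).2) =
      adv_past (advinfo C hC).1 (min_obs h)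
               (cur_rec (astate (run' K' h')) (advinfo C' (run' K' h')).2) &
    forall i, ~~ T i ->
      as_past (adv_feed (astate (run' K' h')) (advinfo C' (run' K' h')).2) i =
      rcons (X K' i).1 ((X K' i).2, safe sA i (X K' i))].
  by rewrite /adv_feed er eqxx -eL -eo; split => // i t; rewrite -iA.
split.
- by apply: (at_node_game aK (gn K) nt _ la c0); rewrite ea.
- by apply: (at_node_game a1 (gn K') nt _ la c0); rewrite ea'.
- by case: (h).
- by rewrite teamof_rcons // (rel_team hrel).
- move=> i t; rewrite infostate_rcons ereps sim_past_rcons iM //.
  rewrite -[LHS]/(rcons (X K' i).1 ((X K' i).2, nxt' (run' K' h') i)).
  by rewrite (in_sync_max a1 sy t).
- by rewrite est.
- by rewrite est fL (adv_past_advinfo tau_ok (rel_at hrel) hn nt (cur_recE sy)).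
- by move=> i t; rewrite est ereps sim_past_rcons fp // /safe -sCA.
Qed.

End Step.

(** The surplus fuel [e], [e'] has no effect because the game is over after [k] more steps of
    [G]. *)
Lemma play_rel k hC h' h e e' : rel hC h' h -> (size h + k = depth G)%N ->
  play C sg tau (k * K.+1 + e) hC = play C' sM sim_adv (k * K'.+1 + e') h'.
Proof.
elim: k hC h' h => [|k IH] hC h' h hr sz;
  have aC := rel_at hr; have aC' := rel_at' hr; have hn := rel_nonnil hr;
  (case: (boolP (terminal G h)) => nt;
    first by rewrite !play_terminal ?(at_node_terminal aC) ?(at_node_terminal aC') //= /cutil
      (an_parse aC) (an_parse aC')).
  by move: nt; rewrite (hrg_depth medG (an_valid aC)) // -sz addn0.
have split_fuel L x : (k.+1 * L.+1 + x = L + (k * L.+1 + x).+1)%N.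
  by rewrite mulSn addnS -addnA addSn.
have aK := an_run medG z0 encO dec f tau_ok aC hn nt (leqnn K).
have a1 := at_node_run sM_ok sim_adv_legal aC' hn (leqnn K') nt.
have gn L : game_node L h L by rewrite /game_node eqxx orbT.
have sg_ok i : max_legal C i (sg i) by exact: protocol_legal.
rewrite !split_fuel (play_comm_run sg_ok tau_ok _ aC) //.
rewrite (play_comm_run sM_ok sim_adv_legal _ aC') //.
rewrite (play_game _ _ _ aK) // (play_game _ _ _ a1) //.
have [a ea la] := joint_act_game sg_ok tau_ok aK (gn K) nt.
apply: eq_bigr => c _; have := hrg_chance_ge0 medG c (an_valid aC) nt.
(* A chance action of probability 0 gives an invalid history, to which [rel] does not extend, but
   its term vanishes. *)
rewrite le_eqVlt => /predU1P[<-|c0]; first by rewrite !mul0r.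
congr (_ * _)%R; apply: IH; first exact: rel_next ea la c0.
by rewrite size_rcons addSnnS.
Qed.

Lemma rel_root c : (0 < chance G [::] c)%R -> team G c = T ->
  rel (root_hist M K medG c) (root_hist M' K' medG c) [:: (root_joint medG, c)].
Proof.
move=> c0 tT; split => //; try exact: at_node_root.
by move=> i _ /=; rewrite !ffunE.
Qed.

Lemma play_sim c : (0 < chance G [::] c)%R -> team G c = T ->
  play C sg tau (depth G * K.+1).-1 (root_hist M K medG c) =
  play C' sM sim_adv (depth G * K'.+1).-1 (root_hist M' K' medG c).
Proof.
move=> c0 tT.
have := valid_size_lt medG (valid_nil G) (hrg_root medG); case ed: (depth G) => [//|d] _.
(* The depth allots [L.+1] moves to every step, but the root takes only one, which leaves a surplus
   of [L]. *)
have fuel L : ((d.+1 * L.+1).-1 = d * L.+1 + L)%N by rewrite mulSn addSn /= addnC.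
by rewrite !fuel; apply: (play_rel _ _ (rel_root c0 tT)); rewrite ed.
Qed.

End Relation.
End Automaton.

End Adversary.
End Simulation.

(** * Payoffs, encodings of observations and actions *)

Section ProductSums.
Local Open Scope ring_scope.
Variables (R : comNzRingType) (I : finType) (T_ : I -> finType).

Lemma sum_dffun_prod (g : forall i, T_ i -> R) :
  \sum_(J : {dffun forall i, T_ i}) \prod_i g i (J i) = \prod_i \sum_k g i k.
Proof.
rewrite (reindex (@dffun_of_fprod I T_)); last exact/onW_bij/dffun_of_fprod_bij.
pose G i := [ffun k : T_ i => g i k].
transitivity (\sum_(t : fprod T_) \prod_(i in I) G i (t i)).
  by apply: eq_bigr => t _; apply: eq_bigr => i _; rewrite /dffun_of_fprod !ffunE.
rewrite big_fprod -(bigA_distr_big_dep _ (fun i j => untag 0 (G i) j)).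
apply: eq_bigr => i _; rewrite -(big_tag (fun i => G i)).
by apply: eq_bigr => k _; rewrite ffunE.
Qed.

Variable w : forall i, T_ i -> R.
Hypothesis w_sum1 : forall i, \sum_k w (i := i) k = 1.
Let W (J : {dffun forall i, T_ i}) := \prod_i w (J i).

Lemma sum_prod1 : \sum_J W J = 1.
Proof. by rewrite sum_dffun_prod big1. Qed.

Definition splice (S : pred I) (J J' : {dffun forall i, T_ i}) : {dffun forall i, T_ i} :=
  finfun (fun i => if S i then J i else J' i).

(* Drawing team MAX from one sample and team MIN from an independent one gives
   the same law as a single sample: exchanging the MIN parts is an involution. *)
Lemma sum_splice (S : pred I) (F : {dffun forall i, T_ i} -> R) :
  \sum_J \sum_J' W J * W J' * F (splice S J J') = \sum_J W J * F J.
Proof.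
rewrite pair_big /=.
pose sw (p : {dffun forall i, T_ i} * {dffun forall i, T_ i}) :=
  (splice S p.1 p.2, splice S p.2 p.1).
have swK : involutive sw.
  by move=> [J J']; rewrite /sw /=; congr (_, _); apply/ffunP => i; rewrite !ffunE; case: (S i).
rewrite (reindex_inj (inv_inj swK)) /=.
transitivity (\sum_(p : {dffun forall i, T_ i} * {dffun forall i, T_ i}) W p.1 * W p.2 * F p.1).
  apply: eq_bigr => -[J J'] _; congr (_ * F _).
    rewrite /W -!big_split /=; apply: eq_bigr => i _; rewrite !ffunE.
    by case: (S i) => //; rewrite mulrC.
  by have [-> _] := swK (J, J').
rewrite -(pair_big predT predT (fun J J' => W J * W J' * F J)) /=; apply: eq_bigr => J _.
under eq_bigr do rewrite mulrAC.
by rewrite -mulr_sumr sum_prod1 mulr1.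
Qed.

End ProductSums.

Lemma sum_marginal (R : comNzRingType) (I A : finType) (w : A -> R) (i0 : I) (F : A -> R) :
  (\sum_k w k = 1 ->
  \sum_(J : {dffun forall i : I, A}) (\prod_i w (J i)) * F (J i0) = \sum_k w k * F k)%R.
Proof.
move=> w1.
transitivity (\sum_(J : {dffun forall i : I, A})
    \prod_i (w (J i) * (if i == i0 then F (J i) else 1)))%R.
  apply: eq_bigr => J _; rewrite big_split /=; congr (_ * _)%R.
  by rewrite (bigD1 i0) //= eqxx big1 ?mulr1 // => i /negPf ->.
rewrite (sum_dffun_prod (fun i k => w k * (if i == i0 then F k else 1))%R).
rewrite (bigD1 i0) //= eqxx [X in (_ * X)%R]big1 ?mulr1 // => i /negPf ->.
by under eq_bigr do rewrite mulr1.
Qed.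

(** * Value of a profile through pure adversaries *)

Section GameValue.
Local Open Scope ring_scope.
Local Open Scope classical_set_scope.
Variables (R : realType) (g : hrg R) (B : R).
Hypothesis chance_ge0 : forall h c, valid g h -> ~~ terminal g h -> 0 <= chance g h c.
Hypothesis chance_sum1 : forall h, valid g h -> ~~ terminal g h -> \sum_c chance g h c = 1.
Hypothesis util_bound : forall h, valid g h -> `|util g h| <= B.
Implicit Types (x : forall i : 'I_(np g), mixed R (max_legal g i)) (tau : advpure g).

Lemma play_bound sg tau k h : (forall i, max_legal g i (sg i)) -> adv_legal g tau ->
  valid g h -> `|play g sg tau k h| <= B.
Proof.
(* Nonnegativity of [B] covers the value 0 that [play] returns when its fuel runs out. *)
move=> sg_ok tau_ok; have B0 : 0 <= B by apply: le_trans (util_bound (h := [::]) _).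
elim: k h => [|k IH] h vh; case: (boolP (terminal g h)) => nt.
- by rewrite play_terminal // util_bound.
- by rewrite /= (negPf nt) normr0.
- by rewrite play_terminal // util_bound.
rewrite playE //; apply: le_trans (ler_norm_sum _ _ _) _.
rewrite -[leRHS]mul1r -[X in _ <= X * _](chance_sum1 vh nt) mulr_suml; apply: ler_sum => c _.
rewrite normrM (ger0_norm (chance_ge0 c vh nt)).
have := chance_ge0 c vh nt; rewrite le_eqVlt => /predU1P[<-|c0]; first by rewrite !mul0r.
rewrite ler_wpM2l ?(ltW c0) // IH // valid_rcons vh nt c0 /= andbT.
by apply/forallP => i; exact: joint_act_legal.
Qed.

Definition pure_payoff x tau : R :=
  \sum_(J : {dffun forall i : 'I_(np g), 'I_(msz (x i))})
    (\prod_i mw (x i) (J i)) * play g (fun i => mp (x i) (J i)) tau (depth g) [::].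

Lemma payoffE x y : payoff g x y = \sum_k mw y k * pure_payoff x (mp y k).
Proof.
rewrite /payoff exchange_big /=; apply: eq_bigr => k _.
by rewrite mulr_sumr; apply: eq_bigr => J _; rewrite mulrCA mulrA mulrC mulrA.
Qed.

Lemma payoff_bound x y : `|payoff g x y| <= B.
Proof.
rewrite payoffE (le_trans (ler_norm_sum _ _ _)) //.
rewrite -[leRHS]mul1r -[X in _ <= X * _](mw_sum1 y) mulr_suml; apply: ler_sum => k _.
rewrite normrM (ger0_norm (mw_ge0 _ _)) ler_wpM2l ?mw_ge0 //.
rewrite (le_trans (ler_norm_sum _ _ _)) //.
rewrite -[leRHS]mul1r -[X in _ <= X * _](sum_prod1 (fun i => mw_sum1 (x i))) mulr_suml.
apply: ler_sum => J _.
rewrite normrM ger0_norm; last by apply: prodr_ge0 => i _; exact: mw_ge0.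
rewrite ler_wpM2l ?play_bound //; last exact: mp_ok.
  by apply: prodr_ge0 => i _; exact: mw_ge0.
by move=> i; exact: mp_ok.
Qed.

Definition pure_mixed (T : Type) (ok : T -> Prop) (t : T) (okt : ok t) : mixed R ok :=
  @Mixed R T ok 1 (fun _ => 1) (fun _ => t) (fun _ => ler01) (big_ord1 _ (fun _ => 1))
    (fun _ => okt).

(** With [le_value], this reduces the value to pure adversaries. The bound on utilities makes the
    infimum a genuine one. *)
Lemma value_le_pure x tau : adv_legal g tau -> value g x <= pure_payoff x tau.
Proof.
move=> tau_ok; apply: ge_inf.
  by exists (- B) => _ [y _ <-]; have := payoff_bound x y; rewrite ler_norml => /andP[].
by exists (pure_mixed tau_ok) => //; rewrite payoffE /= big_ord1 mul1r.
Qed.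

Lemma le_value x v : (exists tau, adv_legal g tau) ->
  (forall tau, adv_legal g tau -> v <= pure_payoff x tau) -> v <= value g x.
Proof.
move=> [tau0 tau0_ok] H; apply: lb_le_inf.
  by exists (payoff g x (pure_mixed tau0_ok)), (pure_mixed tau0_ok).
move=> _ [y _ <-]; rewrite payoffE -[leLHS]mul1r -[X in X * _ <= _](mw_sum1 y) mulr_suml.
by apply: ler_sum => k _; rewrite ler_wpM2l ?mw_ge0 // H //; exact: mp_ok.
Qed.

End GameValue.

(** * Counting histories; encoding observations and actions *)

Section Histories.
Variables (R : realType) (G : hrg R).
Hypothesis medG : mediated_hrg G.
Local Notation n := (np G).

Lemma mem_seqs_len (T : finType) (s : seq T) : s \in seqs_len T (size s).
Proof.
elim/last_ind: s => [//|s x IH]; rewrite size_rcons /=.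
by apply/allpairsP; exists (s, x); rewrite mem_enum.
Qed.

Definition all_hist : seq (hist G) :=
  flatten [seq seqs_len (stepT n (Act G) (CAct G)) k | k <- iota 0 (depth G).+1].

Lemma mem_all_hist (h : hist G) : valid G h -> h \in all_hist.
Proof.
move=> v; apply/flatten_mapP; exists (size h); last exact: mem_seqs_len.
by rewrite mem_iota /= add0n ltnS (valid_size medG).
Qed.

Definition valid_hist : seq (hist G) := [seq h <- all_hist | valid G h].

Lemma size_valid_hist : size valid_hist = nhist G.
Proof. by rewrite /valid_hist size_filter. Qed.

Lemma mem_valid_hist h : (h \in valid_hist) = valid G h.
Proof. by rewrite mem_filter andb_idr // => /mem_all_hist. Qed.

Definition util_max : R := (\sum_(h <- all_hist) `|util G h|)%R.

Lemma util_le_max h : valid G h -> (`|util G h| <= util_max)%R.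
Proof.
move=> /mem_all_hist hin; rewrite /util_max (big_rem h) //= lerDl.
by apply: sumr_ge0.
Qed.

Lemma nhist_gt0 : (0 < nhist G)%N.
Proof.
rewrite -size_valid_hist lt0n size_eq0; apply/eqP => e.
by have := mem_valid_hist [::]; rewrite e.
Qed.

Section Encoding.
Variables (M : nat) (z0 : 'I_M).
Hypothesis leM : (nhist G <= M)%N.

(** The code of an observation is the index of the first valid history showing it; there are at most
    [M] such indices. *)
Lemma encoding_ex : exists encO : 'I_n -> Obs G -> 'I_M, obs_encoding G encO.
Proof.
pose pos i o := find (fun h => `[< obs G i h = o >]) valid_hist.
have posP i h : valid G h -> has (fun h1 => `[< obs G i h1 = obs G i h >]) valid_hist.
  by move=> v; apply/hasP; exists h; [rewrite mem_valid_hist | apply/asboolP].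
exists (fun i o => insubd z0 (pos i o)) => i h1 h2 v1 v2 _ _ _ _ e.
have e2 : pos i (obs G i h1) = pos i (obs G i h2).
  have := congr1 val e; rewrite !val_insubd.
  by rewrite !(leq_trans _ leM) // -size_valid_hist -has_find posP.
have /(nth_find [::])/asboolP <- := posP i h1 v1.
have /(nth_find [::])/asboolP <- := posP i h2 v2.
by rewrite -/(pos i (obs G i h1)) e2.
Qed.

(** Messages index the list of legal actions, and surplus messages mean its head. The list has at
    most [M] entries because distinct legal actions lead to distinct valid children of [h]. *)
Lemma decoding_ex : exists dec : 'I_n -> Obs G -> 'I_M -> Act G, act_decoding G dec.
Proof.
pose acts i o := [seq a <- enum (Act G) | obs_legal i o a].
exists (fun i o m => nth (head (root_act medG i) (acts i o)) (acts i o) m).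
move=> i h v nt _; set o := obs G i h.
have actsP a : (a \in acts i o) = legal G h i a.
  by rewrite mem_filter mem_enum andbT obs_legalE.
split=> [m|a].
  rewrite -actsP; have [b lb] := hrg_legal medG i v nt.
  have : b \in acts i o by rewrite actsP.
  case: (acts i o) => //= b0 l _.
  by case: (ltnP m (size l).+1) => lm; [rewrite mem_nth | rewrite nth_default ?mem_head].
rewrite -actsP => ain; have ia : (index a (acts i o) < size (acts i o))%N by rewrite index_mem.
suff sM : (size (acts i o) <= M)%N.
  by exists (Ordinal (leq_trans ia sM)); rewrite nth_index.
have [c c0] := chance_pos_ex medG v nt.
pose child a : hist G :=
  rcons h ([ffun j => safe_act j (obs G j h) (if j == i then a else root_act medG j)], c).
rewrite (leq_trans _ leM) // -size_valid_hist -(size_map child).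
apply: uniq_leq_size => [|h1 /mapP[b _ ->]]; last first.
  rewrite mem_valid_hist /child valid_rcons v nt c0 andbT.
  by apply/forallP => j; rewrite ffunE; exact: safe_act_legal.
rewrite map_inj_in_uniq; first exact: filter_uniq (enum_uniq _).
move=> b1 b2 l1 l2 /eqP.
rewrite !actsP in l1 l2; rewrite eqseq_rcons eqxx /= => /eqP[/ffunP/(_ i)].
by rewrite !ffunE eqxx !safe_act_id.
Qed.

End Encoding.
End Histories.

Section CommChance.
Local Open Scope ring_scope.
Variables (R : realType) (G : hrg R) (M K : nat).
Hypothesis medG : mediated_hrg G.
Local Notation C := (Comm G M K).

Lemma sum_option (A : finType) (F : option A -> R) :
  \sum_o F o = F None + \sum_a F (Some a).
Proof.
rewrite (bigD1 None) //=; congr (_ + _).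
rewrite (reindex_omap Some id) => [|[a|]//].
by apply: eq_bigl => a; rewrite /= eqxx.
Qed.

Lemma comm_chance_ge0 h c : valid C h -> ~~ terminal C h -> 0 <= chance C h c.
Proof.
move=> /at_node_ex[h1 [r an]]; rewrite (at_node_terminal an) => nt.
rewrite /= /cchance (an_parse an); case: ifP => _; case: c => // c.
exact: hrg_chance_ge0 (an_valid an) nt.
Qed.

Lemma comm_chance_sum h : valid C h -> ~~ terminal C h -> \sum_c chance C h c = 1.
Proof.
move=> /at_node_ex[h1 [r an]]; rewrite (at_node_terminal an) => nt.
rewrite /= sum_option /cchance (an_parse an); case: ifP => _ /=.
  by rewrite add0r (hrg_chance_sum medG (an_valid an)).
by rewrite big1 ?addr0.
Qed.

Lemma comm_util_bound h : valid C h -> `|util C h| <= util_max G.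
Proof.
move=> /at_node_ex[h1 [r an]]; rewrite /= /cutil (an_parse an).
exact: util_le_max (an_valid an).
Qed.

End CommChance.

(** * Optimal mixtures *)

Section MaxMin.
Local Open Scope ring_scope.
Local Open Scope classical_set_scope.
Variables (R : realType) (N : nat) (T : Type) (t0 : T) (P : 'I_N -> T -> R) (B : R).
Hypothesis PB : forall k t, `|P k t| <= B.

Definition prob (w : 'I_N -> R) : Prop := (forall k, 0 <= w k) /\ \sum_k w k = 1.

Definition guarantee (w : 'I_N -> R) : R := inf (range (fun t => \sum_k w k * P k t)).

Lemma guarantee_le w t : guarantee w <= \sum_k w k * P k t.
Proof.
apply: ge_inf; last by exists t.
exists (- \sum_k `|w k| * B) => _ [s _ <-]; rewrite lerNl -sumrN; apply: ler_sum => k _.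
rewrite (le_trans (ler_norm _)) // normrN normrM ler_wpM2l //.
Qed.

Lemma le_guarantee w x : (forall t, x <= \sum_k w k * P k t) -> x <= guarantee w.
Proof. by move=> H; apply: lb_le_inf; [exists (\sum_k w k * P k t0), t0 | move=> _ [t _ <-]]. Qed.

(** An infimum of functions with a common Lipschitz constant inherits it; this works for an infinite
    set [T] of adversaries. *)
Lemma guarantee_lip w w' : guarantee w - guarantee w' <= B * \sum_k `|w' k - w k|.
Proof.
rewrite lerBlDr -lerBlDl; apply: le_guarantee => t; rewrite lerBlDl addrC.
rewrite (le_trans (guarantee_le w t)) // -lerBlDl -sumrB mulr_sumr; apply: ler_sum => k _.
rewrite -mulrBl (le_trans (ler_norm _)) // normrM mulrC distrC ler_wpM2r //.
Qed.

Lemma continuous_guarantee : continuous (fun v : 'rV[R]_N => guarantee (v ord0)).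
Proof.
move=> v; apply/(@cvgrPdist_le R R _ (nbhs v) (nbhs_filter v)) => e e0.
have B0 : 0 <= B \/ N = 0%N.
  case: (posnP N) => [|N0]; [by right|left].
  exact: le_trans (normr_ge0 _) (PB (Ordinal N0) t0).
(* Chosen so that [N] coordinates, each moving by at most [d], change the guarantee by at most [e];
   the 1 keeps the denominator positive. *)
pose d := e / (`|B| * N%:R + 1).
have d0 : 0 < d by rewrite divr_gt0 // ltr_wpDl // mulr_ge0 // ler0n.
near=> u.
have lip x y : (forall k, `|x k - y k| <= d) -> guarantee x - guarantee y <= e.
  move=> H; apply: le_trans (guarantee_lip x y) _.
  apply: (@le_trans _ _ (`|B| * (N%:R * d))).
    apply: (@le_trans _ _ (`|B| * \sum_k `|y k - x k|)).
      by rewrite ler_wpM2r ?ler_norm // sumr_ge0.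
    rewrite ler_wpM2l // -[N in N%:R]card_ord mulr_natl -sumr_const ler_sum // => k _.
    by rewrite distrC.
  rewrite mulrA /d mulrCA -[leRHS]mulr1 ler_wpM2l ?(ltW e0) //.
  rewrite ler_pdivrMr ?mul1r ?lerDl // ltr_wpDl // mulr_ge0 // ler0n.
have near_u : forall k, `|v ord0 k - u ord0 k| <= d.
  near: u; apply: filter_forall => k.
  by have /cvgrPdist_le := @coord_continuous _ 1 N ord0 k v; apply.
rewrite ler_norml lerNl opprB !lip // => k; rewrite distrC //.
Unshelve. all: by end_near.
Qed.

(** The probability simplex is a closed subset of the compact unit cube. *)
Lemma compact_prob : compact [set v : 'rV[R]_N | prob (v ord0)].
Proof.
have cS : compact [set v : 'rV[R]_N | forall i, `[0%R, 1%R]%classic (v ord0 i)].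
  exact: (@rV_compact R N (fun _ => `[0%R, 1%R]%classic) (fun _ => @segment_compact R 0 1)).
have sum_cont : continuous (fun v : 'rV[R]_N => \sum_k v ord0 k).
  move=> v; have := (@cvg_big R 'I_N +%R 0 xpredT (@add_continuous R) 'rV[R]_N (nbhs v)
    (index_enum 'I_N) (fun k u => u ord0 k) (fun k => v ord0 k) (nbhs_filter v)). apply => k _.
  exact: coord_continuous.
apply: (subclosed_compact _ cS); last first.
  move=> v /= [v0 v1] i; rewrite in_itv /= v0 /= -v1 (bigD1 i) //= lerDl sumr_ge0 //.
have -> : [set v : 'rV[R]_N | prob (v ord0)] =
    \bigcap_(i in [set: 'I_N]) ((fun v : 'rV[R]_N => v ord0 i) @^-1` [set x | 0 <= x]) `&`
    ((fun v : 'rV[R]_N => \sum_k v ord0 k) @^-1` [set x | x = 1]).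
  by apply/seteqP; split => v /= [H ?]; split => // i; [move=> _|]; exact: H.
apply: closedI; [apply: closed_bigI => i _|];
  (apply: preimage_closed; [|exact: closed_ge || exact: closed_eq]) => v _.
  exact: coord_continuous.
exact: sum_cont.
Qed.

Theorem guarantee_max : (0 < N)%N ->
  exists2 w, prob w & forall w', prob w' -> guarantee w' <= guarantee w.
Proof.
move=> N0; pose A := [set v : 'rV[R]_N | prob (v ord0)].
have A0 : A !=set0.
  exists (\row_k (if k == Ordinal N0 then 1 else 0)); split=> [k|].
    by rewrite mxE; case: ifP.
  by rewrite (bigD1 (Ordinal N0)) //= big1 ?mxE ?eqxx ?addr0 // => k /negPf nk; rewrite mxE nk.
have [v vA vmax] := EVT_max_rV A0 compact_prob (continuous_subspaceT continuous_guarantee).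
exists (v ord0); first by rewrite inE in vA.
move=> w pw; have := vmax (\row_k w k); rewrite inE /A /=.
have -> : (\row_k w k) ord0 = w by apply/funext => k; rewrite mxE.
exact.
Qed.

End MaxMin.

(** * The revelation principle *)

Section Main.
Local Open Scope ring_scope.
Local Open Scope classical_set_scope.
Variables (R : realType) (G : hrg R) (M K : nat).
Hypothesis medG : mediated_hrg G.
Hypothesis K_gt1 : (1 < K)%N.
Variable z0 : 'I_M.
Variables (encO : 'I_(np G) -> Obs G -> 'I_M)
  (dec : 'I_(np G) -> Obs G -> 'I_M -> Act G).
Hypothesis encP : obs_encoding G encO.
Hypothesis decP : act_decoding G dec.
Local Notation C := (Comm G M K).
Local Notation n := (np G).
Local Notation med := (mediator G).

(* Mediator strategies up to payoff equivalence: at most depth G reports occur. *)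
Definition med_code : finType := {ffun (depth G).-bseq (reportT G M) -> {ffun 'I_n -> 'I_M}}.

Definition decode (f : med_code) : mediatorT G M := fun rhos =>
  if insub rhos is Some b then f b else [ffun _ => z0].

Local Notation prot f := (protocol (K := K) medG z0 encO dec f).

Lemma protocol_other f f' i : i != med -> prot f i = prot f' i.
Proof. by move=> /negPf im; apply/funext => X; rewrite /protocol /raw_protocol im. Qed.

Definition advT := {tau : advpure C | adv_legal C tau}.

Definition code_payoff (k : 'I_#|med_code|) (t : advT) : R :=
  play C (prot (decode (enum_val k))) (sval t) (depth C) [::].

(** All players draw from [w] independently, but by [protocol_other] only the mediator's draw
    matters, so no correlation between players is needed. *)
Definition code_profile (w : 'I_#|med_code| -> R) (pw : prob w) (i : 'I_n)
    : mixed R (max_legal C i) :=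
  @Mixed R _ (max_legal C i) _ w (fun k => prot (decode (enum_val k)) i) pw.1 pw.2
    (fun k => @protocol_legal R G M K medG z0 encO dec (decode (enum_val k)) i).

Lemma pure_payoff_code w (pw : prob w) (t : advT) :
  pure_payoff (g := C) (code_profile pw) (sval t) = \sum_k w k * code_payoff k t.
Proof.
rewrite -(sum_marginal med (fun k => code_payoff k t) pw.2) /pure_payoff.
apply: eq_bigr => J _; congr (_ * play _ _ _ _ _); apply/funext => i /=.
by case: (eqVneq i med) => [->//|im]; exact: protocol_other.
Qed.

Lemma code_payoff_bound k t : `|code_payoff k t| <= util_max G.
Proof.
apply: (play_bound (comm_chance_ge0 medG) (comm_chance_sum medG) (comm_util_bound medG)) => //.
- by move=> i; exact: protocol_legal.
- exact: (svalP t).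
Qed.

(** [sim_adv] is legal whatever strategies it is built from, so constant ones suffice. *)
Lemma dummy_adv_legal : exists tau, adv_legal C tau.
Proof.
eexists; exact: (sim_adv_legal medG z0 z0 encO dec
  (fun _ => [ffun i => inl (root_act medG i)] : {ffun 'I_n -> Act C})
  (fun i _ => inl (root_act medG i) : Act C)).
Qed.

Section Revelation.
Variables (M' K' : nat) (z0' : 'I_M').
Local Notation C' := (Comm G M' K').
Variable x' : forall i : 'I_n, mixed R (max_legal C' i).
Local Notation sampleT := {dffun forall i : 'I_n, 'I_(msz (x' i))}.

Definition sample_profile (J : sampleT) : 'I_n -> maxpure C' := fun i => mp (x' i) (J i).

Definition sample_weight (J : sampleT) : R := \prod_i mw (x' i) (J i).

Definition sample_code (J : sampleT) : med_code :=
  [ffun b => sim_mediator medG z0 z0' encO dec (sample_profile J) (val b)].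

(** The law of the mediator's code when the sample [J] is drawn from [x']. *)
Definition revealed (k : 'I_#|med_code|) : R :=
  \sum_(J | enum_rank (sample_code J) == k) sample_weight J.

Lemma sample_weight_ge0 J : 0 <= sample_weight J.
Proof. by apply: prodr_ge0 => i _; exact: mw_ge0. Qed.

Lemma sample_weight_sum1 : \sum_J sample_weight J = 1.
Proof. exact: (sum_prod1 (fun i => mw_sum1 (x' i))). Qed.

Lemma revealed_sum (F : 'I_#|med_code| -> R) :
  \sum_k revealed k * F k = \sum_J sample_weight J * F (enum_rank (sample_code J)).
Proof.
rewrite [RHS](partition_big (fun J => enum_rank (sample_code J)) predT) //=.
apply: eq_bigr => k _; rewrite mulr_suml; apply: eq_big => // J /eqP ->.
by [].
Qed.

Lemma revealed_prob : prob revealed.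
Proof.
split=> [k|]; first by apply: sumr_ge0 => J _; exact: sample_weight_ge0.
have := revealed_sum (fun _ => 1); under eq_bigr do rewrite mulr1.
by move=> ->; under eq_bigr do rewrite mulr1; exact: sample_weight_sum1.
Qed.

Lemma decode_sample J rhos : (size rhos <= depth G)%N ->
  decode (sample_code J) rhos = sim_mediator medG z0 z0' encO dec (sample_profile J) rhos.
Proof. by move=> le; rewrite /decode insubT ffunE. Qed.

Lemma depth_gt0 L : (0 < depth G * L.+1)%N.
Proof. by rewrite muln_gt0 (valid_size_lt medG (valid_nil G) (hrg_root medG)). Qed.

Lemma revelation : value C' x' <= guarantee code_payoff revealed.
Proof.
have [tau0 tau0_ok] := dummy_adv_legal.
apply: (le_guarantee (exist _ tau0 tau0_ok)) => -[tau tau_ok].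
rewrite revealed_sum.
pose adv J := sim_adv (K := K) (K' := K') medG z0 z0' encO dec tau (sample_profile J).
have adv_ok J : adv_legal C' (adv J) by exact: sim_adv_legal.
have mp_legal J i : max_legal C' i (sample_profile J i) by exact: mp_ok.
(* The right-hand side averages payoffs of [x'] against the pure adversaries [adv J'], each at least
   the value of [x']. *)
suff -> : \sum_J sample_weight J * code_payoff (enum_rank (sample_code J)) (exist _ tau tau_ok) =
    \sum_J' sample_weight J' * pure_payoff (g := C') x' (adv J').
  rewrite -[leLHS]mul1r -[X in X * _ <= _]sample_weight_sum1 mulr_suml; apply: ler_sum => J _.
  rewrite ler_wpM2l ?sample_weight_ge0 //.
  exact: (value_le_pure (comm_chance_ge0 medG) (comm_chance_sum medG) (comm_util_bound medG)).
pose A c J := play C (prot (decode (sample_code J))) tau (depth G * K.+1).-1 (root_hist M K medG c).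
pose A' c J J' := play C' (sample_profile J) (adv J') (depth G * K'.+1).-1 (root_hist M' K' medG c).
transitivity (\sum_c chance G [::] c * \sum_J sample_weight J * A c J).
  under [RHS]eq_bigr do rewrite mulr_sumr; rewrite exchange_big /=.
  apply: eq_bigr => J _; rewrite /code_payoff enum_rankK /= -(prednK (depth_gt0 K)).
  rewrite (play_root medG) // => [|i]; last exact: protocol_legal.
  by rewrite mulr_sumr; apply: eq_bigr => c _; rewrite mulrCA.
transitivity (\sum_c chance G [::] c *
    \sum_J \sum_J' sample_weight J * sample_weight J' * A' c J J').
  apply: eq_bigr => c _; have := hrg_chance_ge0 medG c (valid_nil G) (hrg_root medG).
  rewrite le_eqVlt => /predU1P[<-|c0]; first by rewrite !mul0r.
  (* Once [c] fixes the teams, the mediator's single draw splits into a MAX part [J] and a MIN part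
     [J']. The adversary [adv J'] itself does not depend on [c]. *)
  rewrite -(sum_splice (fun i => mw_sum1 (x' i)) (team G c)); congr (_ * _).
  apply: eq_bigr => J _; apply: eq_bigr => J' _; congr (_ * _).
  have fP := decode_sample (splice (team G c) J J').
  apply: (play_sim K_gt1 encP decP (mp_legal J) tau_ok _ _ fP c0 erefl) => i t.
    by rewrite /sample_profile ffunE t.
  by rewrite /sample_profile ffunE (negPf t).
under eq_bigr do rewrite exchange_big mulr_sumr /=.
rewrite exchange_big /=; apply: eq_bigr => J' _.
under eq_bigr do rewrite mulr_sumr; rewrite exchange_big mulr_sumr /=; apply: eq_bigr => J _.
rewrite /= -(prednK (depth_gt0 K')) (play_root medG) ?mulr_sumr; [|exact: mp_legal|exact: adv_ok].
apply: eq_bigr => c _; rewrite mulrA [RHS]mulrA [RHS]mulrA; congr (_ * _).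
by rewrite mulrC (mulrC (sample_weight J)).
Qed.

End Revelation.

Lemma dummy_profile (M' K' : nat) (z0' : 'I_M') :
  exists x : forall i : 'I_n, mixed R (max_legal (Comm G M' K') i), True.
Proof.
pose s i : maxpure (Comm G M' K') := fun X =>
  san medG z0' i (rcons (unzip1 X.1) X.2) (inl (root_act medG i)).
have s_ok i : max_legal (Comm G M' K') i (s i) by move=> h v nt _; exact: san_legal.
by exists (fun i => pure_mixed R (s_ok i)).
Qed.

(** The best mixture guarantees at least as much as each [revealed] one, hence at least the value of
    any profile of any extension; being a profile of [C], it attains the supremum. *)
Lemma optimal_protocol : exists2 w : 'I_#|med_code| -> R, prob w &
  forall pw : prob w, value C (code_profile pw) = CVal_priv G.
Proof.
have [tau0 tau0_ok] := dummy_adv_legal.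
have N0 : (0 < #|med_code|)%N by apply/card_gt0P; exists [ffun _ => [ffun _ => z0]].
have [w pw wmax] := guarantee_max (exist _ tau0 tau0_ok : advT) code_payoff_bound N0.
exists w => // {}pw.
have ge_opt : guarantee code_payoff w <= value C (code_profile pw).
  apply: le_value; first exact: dummy_adv_legal.
  move=> tau tau_ok; rewrite (pure_payoff_code pw (exist _ tau tau_ok)).
  exact: (guarantee_le code_payoff_bound).
have opt M' K' (x' : forall i : 'I_n, mixed R (max_legal (Comm G M' K') i)) :
    (0 < M')%N -> value (Comm G M' K') x' <= value C (code_profile pw).
  move=> M0; apply: le_trans ge_opt.
  apply: le_trans (revelation (Ordinal M0) x') _.
  exact: wmax (revealed_prob _ _).
have tme_le M' K' : (0 < M')%N -> tme (Comm G M' K') <= value C (code_profile pw).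
  move=> M0; have [x' _] := dummy_profile K' (Ordinal M0).
  by apply: ge_sup; [exists (value (Comm G M' K') x'), x' | move=> _ [x1 _ <-]; exact: opt].
have M0 : (0 < M)%N by apply: leq_ltn_trans (ltn_ord z0).
have K0 : (0 < K)%N by apply: ltn_trans K_gt1.
apply/eqP; rewrite eq_le; apply/andP; split.
  (* The same domination provides the upper bounds under which both suprema are genuine. *)
  apply: (@le_trans _ _ (tme C)).
    apply: ub_le_sup; last by exists (code_profile pw).
    by exists (value C (code_profile pw)) => _ [x1 _ <-]; exact: opt.
  apply: ub_le_sup; last by exists M, K.
  by exists (value C (code_profile pw)) => _ [M1 [K1 [M10 _ ->]]]; exact: tme_le.
apply: ge_sup; first by exists (tme C), M, K.
by move=> _ [M1 [K1 [M10 _ ->]]]; exact: tme_le.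
Qed.

End Main.

Theorem theorem4p1 (R : realType) (G : hrg R) (M K : nat) :
  mediated_hrg G -> (2 <= K)%N -> (nhist G <= M)%N ->
  exists (x : forall i : 'I_(np G), mixed R (max_legal (Comm G M K) i))
         (encO : 'I_(np G) -> Obs G -> 'I_M)
         (dec : 'I_(np G) -> Obs G -> 'I_M -> Act G),
    [/\ value (Comm G M K) x = CVal_priv G,
        obs_encoding G encO,
        act_decoding G dec &
        forall (i : 'I_(np G)) (k : 'I_(msz (x i))), (0 < mw (x i) k)%R ->
          follows_protocol G M K encO dec i (mp (x i) k)].
Proof.
move=> medG K2 leM.
have M0 : (0 < M)%N by apply: leq_trans leM; exact: nhist_gt0.
have [encO encP] := encoding_ex medG (Ordinal M0) leM.
have [dec decP] := decoding_ex medG leM.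
(* [Ordinal M0] is message 0, which the protocol prescribes on the public channel. *)
have [w pw wval] := optimal_protocol medG K2 (Ordinal M0) encP decP.
exists (code_profile K medG (Ordinal M0) encO dec pw), encO, dec; split => // i k _.
exact: protocol_follows.
Qed.
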